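(* Let $F$ be a field and let $A$, $B$, $C$ be finite-dimensional local $F$-algebras such that $F$ is a splitting field for each of them. If $A \otimes C \cong B \otimes C$ as $F$-algebras, then $A \cong B$ as $F$-algebras.
   Context: All algebras are associative, finite-dimensional over the field $F$, with identity $1 \neq 0$ (not necessarily commutative). All tensor products $\otimes$ are over $F$. For an algebra $A$ with Jacobson radical $J_A$: $A$ is local if $A/J_A$ is a division algebra; $F$ is a splitting field for $A$ if $A/J_A$ is isomorphic to a direct product of matrix algebras over $F$. *)

(* Defs.v *)
From HB Require Import structures.
From mathcomp Require Import all_boot all_order all_algebra all_field.
From mathcomp Require Import boolp.

Set Implicit Arguments.
Unset Strict Implicit.
Unset Printing Implicit Defensive.

Import GRing.Theory.
Local Open Scope ring_scope.

(* Finite-dimensional unital F-algebras with 1 != 0 are terms of falgType F.  *)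
(* The definition is for algType F, so that it also applies to prodalg below. *)
Definition alg_iso (F : fieldType) (A B : algType F) : Prop :=
  exists f : {lrmorphism A -> B}, bijective f.

Section DirectProduct.
Variables (F : fieldType) (n : nat) (T : 'I_n.+1 -> algType F).

Definition prodalg : Type := {dffun forall i, T i}.
HB.instance Definition _ := Choice.on prodalg.

Implicit Types f g h : prodalg.

Definition prodalg_zero : prodalg := [ffun i => 0 : T i].
Definition prodalg_opp f : prodalg := [ffun i => - f i].
Definition prodalg_add f g : prodalg := [ffun i => f i + g i].
Definition prodalg_one : prodalg := [ffun i => 1 : T i].
Definition prodalg_mul f g : prodalg := [ffun i => f i * g i].
Definition prodalg_scale (a : F) f : prodalg := [ffun i => a *: f i].

Fact prodalg_addA : associative prodalg_add.
Proof. by move=> f g h; apply/ffunP=> i; rewrite !ffunE addrA. Qed.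
Fact prodalg_addC : commutative prodalg_add.
Proof. by move=> f g; apply/ffunP=> i; rewrite !ffunE addrC. Qed.
Fact prodalg_add0 : left_id prodalg_zero prodalg_add.
Proof. by move=> f; apply/ffunP=> i; rewrite !ffunE add0r. Qed.
Fact prodalg_addN : left_inverse prodalg_zero prodalg_opp prodalg_add.
Proof. by move=> f; apply/ffunP=> i; rewrite !ffunE addNr. Qed.

HB.instance Definition _ := GRing.isZmodule.Build prodalg
  prodalg_addA prodalg_addC prodalg_add0 prodalg_addN.

Fact prodalg_mulA : associative prodalg_mul.
Proof. by move=> f g h; apply/ffunP=> i; rewrite !ffunE mulrA. Qed.
Fact prodalg_mul1l : left_id prodalg_one prodalg_mul.
Proof. by move=> f; apply/ffunP=> i; rewrite !ffunE mul1r. Qed.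
Fact prodalg_mul1r : right_id prodalg_one prodalg_mul.
Proof. by move=> f; apply/ffunP=> i; rewrite !ffunE mulr1. Qed.
Fact prodalg_mulDl : left_distributive prodalg_mul +%R.
Proof. by move=> f g h; apply/ffunP=> i; rewrite !ffunE mulrDl. Qed.
Fact prodalg_mulDr : right_distributive prodalg_mul +%R.
Proof. by move=> f g h; apply/ffunP=> i; rewrite !ffunE mulrDr. Qed.
Fact prodalg_1neq0 : prodalg_one != 0.
Proof.
by apply/eqP=> /ffunP/(_ ord0); rewrite !ffunE => /eqP; rewrite oner_eq0.
Qed.

HB.instance Definition _ := GRing.Zmodule_isNzRing.Build prodalg
  prodalg_mulA prodalg_mul1l prodalg_mul1r prodalg_mulDl prodalg_mulDr
  prodalg_1neq0.

Fact prodalg_scaleA a b f :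
  prodalg_scale a (prodalg_scale b f) = prodalg_scale (a * b) f.
Proof. by apply/ffunP=> i; rewrite !ffunE scalerA. Qed.
Fact prodalg_scale1 : left_id 1 prodalg_scale.
Proof. by move=> f; apply/ffunP=> i; rewrite !ffunE scale1r. Qed.
Fact prodalg_scaleDr : right_distributive prodalg_scale +%R.
Proof. by move=> a f g; apply/ffunP=> i; rewrite !ffunE scalerDr. Qed.
Fact prodalg_scaleDl f : {morph prodalg_scale^~ f : a b / a + b}.
Proof. by move=> a b; apply/ffunP=> i; rewrite !ffunE scalerDl. Qed.

HB.instance Definition _ := GRing.Zmodule_isLmodule.Build F prodalg
  prodalg_scaleA prodalg_scale1 prodalg_scaleDr prodalg_scaleDl.

Fact prodalg_scaleAl (a : F) f g : a *: (f * g) = a *: f * g.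
Proof. by apply/ffunP=> i; rewrite !ffunE scalerAl. Qed.
HB.instance Definition _ :=
  GRing.Lmodule_isLalgebra.Build F prodalg prodalg_scaleAl.

Fact prodalg_scaleAr (a : F) f g : a *: (f * g) = f * (a *: g).
Proof. by apply/ffunP=> i; rewrite !ffunE scalerAr. Qed.
HB.instance Definition _ :=
  GRing.Lalgebra_isAlgebra.Build F prodalg prodalg_scaleAr.

End DirectProduct.

Section Quotient.
Variables (F : fieldType) (A : falgType F).

(* Proper two-sided ideals, which are subspaces since A is unital. *)
Record tsideal := TSIdeal {
  tsideal_vs :> {vspace A};
  tsidealP : [&& (fullv * tsideal_vs <= tsideal_vs)%VS,
                 (tsideal_vs * fullv <= tsideal_vs)%VS
               & 1 \notin tsideal_vs] }.

Variable I : tsideal.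

(* A / I, carried by a linear complement of I: each coset of I has a unique   *)
(* representative there. The multiplication is the one making the projection  *)
(* quot_pi an algebra morphism; quot_pi_lrmorphism, quot_pi_surj and          *)
(* quot_pi_eq0 pin down A / I up to isomorphism.                              *)
Definition quotalg : Type := subvs_of (I : {vspace A})^C.
HB.instance Definition _ := Vector.copy quotalg (subvs_of (I : {vspace A})^C).

Definition quot_pi (x : A) : quotalg :=
  vsproj (I : {vspace A})^C (daddv_pi (I : {vspace A})^C I x).
Definition quot_repr (u : quotalg) : A := vsval u.

Lemma tsideal_mull x y : y \in (I : {vspace A}) -> x * y \in (I : {vspace A}).
Proof.
move=> Iy; case/and3P: (tsidealP I) => /prodvP sAI _ _.
exact: sAI (memvf _) Iy.
Qed.

Lemma tsideal_mulr x y : x \in (I : {vspace A}) -> x * y \in (I : {vspace A}).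
Proof.
move=> Ix; case/and3P: (tsidealP I) => _ /prodvP sIA _.
exact: sIA Ix (memvf _).
Qed.

Fact quot_pi_is_linear : linear quot_pi.
Proof. by move=> a x y; rewrite /quot_pi !linearP. Qed.
HB.instance Definition _ :=
  GRing.isLinear.Build F A quotalg _ quot_pi quot_pi_is_linear.

Let compl_cap : ((I : {vspace A})^C :&: I = 0)%VS.
Proof. by rewrite capvC capv_compl. Qed.

Lemma quot_reprK : cancel quot_repr quot_pi.
Proof.
move=> u; rewrite /quot_pi /quot_repr daddv_pi_id //; last exact: subvsP.
exact: vsvalK.
Qed.

Lemma quot_pi_surj (u : quotalg) : exists x, quot_pi x = u.
Proof. by exists (quot_repr u); rewrite quot_reprK. Qed.

Lemma quot_piK x : x - quot_repr (quot_pi x) \in (I : {vspace A}).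
Proof.
rewrite /quot_repr /quot_pi vsprojK ?memv_pi //.
rewrite -{1}(@daddv_pi_add _ _ (I : {vspace A})^C I x) //.
  by rewrite addrC addKr memv_pi.
by rewrite addvC addv_complf memvf.
Qed.

Lemma quot_pi_eq0 x : (quot_pi x == 0) = (x \in (I : {vspace A})).
Proof.
apply/eqP/idP => [p0 | Ix].
  by rewrite -[x]subr0; have := quot_piK x; rewrite p0.
have I_repr : quot_repr (quot_pi x) \in (I : {vspace A}).
  rewrite -[quot_repr _](subKr x); apply: rpredB => //; exact: quot_piK.
have: quot_repr (quot_pi x) \in ((I : {vspace A})^C :&: I)%VS.
  by rewrite memv_cap I_repr andbT; apply: subvsP.
by rewrite compl_cap memv0 => /eqP r0; apply: val_inj.
Qed.

Lemma quot_pi_eqP x y :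
  reflect (quot_pi x = quot_pi y) (x - y \in (I : {vspace A})).
Proof. by rewrite -quot_pi_eq0 linearB subr_eq0; apply: eqP. Qed.

Definition quot_one : quotalg := quot_pi 1.
Definition quot_mul (u v : quotalg) : quotalg :=
  quot_pi (quot_repr u * quot_repr v).

Lemma quot_piM x y : quot_pi (x * y) = quot_mul (quot_pi x) (quot_pi y).
Proof.
apply/quot_pi_eqP; set x' := quot_repr _; set y' := quot_repr _.
have ->: x * y - x' * y' = (x - x') * y + x' * (y - y').
  by rewrite mulrBl mulrBr addrA subrK.
by apply: rpredD; [apply: tsideal_mulr | apply: tsideal_mull]; apply: quot_piK.
Qed.

Fact quot_mulA : associative quot_mul.
Proof.
move=> u v w; case: (quot_pi_surj u) (quot_pi_surj v) (quot_pi_surj w).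
by move=> x <- [y <-] [z <-]; rewrite -!quot_piM mulrA.
Qed.
Fact quot_mul1l : left_id quot_one quot_mul.
Proof.
by move=> u; case: (quot_pi_surj u) => x <-; rewrite -quot_piM mul1r.
Qed.
Fact quot_mul1r : right_id quot_one quot_mul.
Proof.
by move=> u; case: (quot_pi_surj u) => x <-; rewrite -quot_piM mulr1.
Qed.
Fact quot_mulDl : left_distributive quot_mul +%R.
Proof.
move=> u v w; case: (quot_pi_surj u) (quot_pi_surj v) (quot_pi_surj w).
by move=> x <- [y <-] [z <-]; rewrite -linearD -!quot_piM mulrDl linearD.
Qed.
Fact quot_mulDr : right_distributive quot_mul +%R.
Proof.
move=> u v w; case: (quot_pi_surj u) (quot_pi_surj v) (quot_pi_surj w).
by move=> x <- [y <-] [z <-]; rewrite -linearD -!quot_piM mulrDr linearD.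
Qed.
Fact quot_1neq0 : quot_one != 0.
Proof. by rewrite quot_pi_eq0; case/and3P: (tsidealP I). Qed.

HB.instance Definition _ := GRing.Zmodule_isNzRing.Build quotalg
  quot_mulA quot_mul1l quot_mul1r quot_mulDl quot_mulDr quot_1neq0.

Fact quot_scaleAl (a : F) (u v : quotalg) : a *: (u * v) = a *: u * v.
Proof.
case: (quot_pi_surj u) (quot_pi_surj v) => x <- [y <-].
have piM z t : quot_pi z * quot_pi t = quot_pi (z * t) by rewrite quot_piM.
by rewrite piM -!linearZ piM scalerAl.
Qed.
HB.instance Definition _ :=
  GRing.Lmodule_isLalgebra.Build F quotalg quot_scaleAl.

Fact quot_scaleAr (a : F) (u v : quotalg) : a *: (u * v) = u * (a *: v).
Proof.
case: (quot_pi_surj u) (quot_pi_surj v) => x <- [y <-].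
have piM z t : quot_pi z * quot_pi t = quot_pi (z * t) by rewrite quot_piM.
by rewrite piM -!linearZ piM scalerAr.
Qed.
HB.instance Definition _ :=
  GRing.Lalgebra_isAlgebra.Build F quotalg quot_scaleAr.

HB.instance Definition _ := Algebra_isFalgebra.Build F quotalg.

Fact quot_pi_lrmorphism : monoid_morphism quot_pi.
Proof. by split=> // x y; apply: quot_piM. Qed.
HB.instance Definition _ :=
  GRing.isMonoidMorphism.Build A quotalg quot_pi quot_pi_lrmorphism.

End Quotient.

Section Jacobson.
Variables (F : fieldType) (A : falgType F).
Implicit Types (M N : {vspace A}) (P : {vspace A} -> Prop).

(* Left ideals of a unital algebra are subspaces. *)
Definition left_ideal M : Prop := (fullv * M <= M)%VS.

Definition maximal_left_ideal M : Prop :=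
  [/\ left_ideal M, M <> fullv
    & forall N, left_ideal N -> (M <= N)%VS -> N <> fullv -> N = M].

Lemma vinter_exists P :
  exists J : {vspace A}, forall x, x \in J <-> (forall M, P M -> x \in M).
Proof.
pose Q d := `[< exists s : seq {vspace A},
  (forall M, M \in s -> P M) /\ \dim (\bigcap_(M <- s) M)%VS = d >].
have exQ : exists d, Q d.
  by exists (\dim {:A}); apply/asboolP; exists [::]; rewrite big_nil; split.
case: (ex_minnP exQ) => d /asboolP[s [sP sd]] dmin.
exists (\bigcap_(M <- s) M)%VS => x; split=> [xs M PM | xP]; last first.
  elim: s sP {sd} => [|M s IHs] sP; first by rewrite big_nil memvf.
  rewrite big_cons memv_cap xP; last by apply: sP; rewrite mem_head.
  by apply: IHs => N sN; apply: sP; rewrite inE sN orbT.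
have le_d : (d <= \dim (\bigcap_(N <- M :: s) N)%VS)%N.
  apply: dmin; apply/asboolP; exists (M :: s); split=> // N.
  by rewrite inE => /predU1P[-> // | /sP].
rewrite big_cons in le_d.
have /eqP Ds : (M :&: \bigcap_(N <- s) N == \bigcap_(N <- s) N)%VS.
  by rewrite eqEdim capvSr sd le_d.
by move: xs; rewrite -Ds memv_cap => /andP[].
Qed.

(* The intersection of all maximal left ideals, see jacobson_vsP. *)
Definition jacobson_vs : {vspace A} :=
  projT1 (cid (vinter_exists maximal_left_ideal)).

Lemma jacobson_vsP x :
  x \in jacobson_vs <-> (forall M, maximal_left_ideal M -> x \in M).
Proof. by rewrite /jacobson_vs; case: cid. Qed.

Lemma left_idealP M : left_ideal M -> forall a x, x \in M -> a * x \in M.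
Proof. by move=> /prodvP MA a x Mx; apply: MA; rewrite ?memvf. Qed.

Lemma one_notin_left_ideal M : left_ideal M -> M <> fullv -> 1 \notin M.
Proof.
move=> lM nM; apply/negP=> M1; apply: nM; apply/vspaceP=> x.
by rewrite memvf -[x]mulr1 left_idealP.
Qed.

Lemma maximal_left_ideal_exists : exists M, maximal_left_ideal M.
Proof.
pose Q d := `[< exists M, [/\ left_ideal M, M <> fullv & \dim M = d] >].
have exQ : exists d, Q d.
  exists 0; apply/asboolP; exists 0%VS; split; last exact: dimv0.
    by rewrite /left_ideal prodv0.
  move=> /vspaceP/(_ 1); rewrite memv0 memvf.
  by rewrite oner_eq0.
have Qle d : Q d -> (d <= \dim {:A})%N.
  by case/asboolP=> M [_ _ <-]; apply: dimvS; apply: subvf.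
case: (ex_maxnP exQ Qle) => d /asboolP[M [lM nM dM]] dmax.
exists M; split=> // N lN sMN nN.
apply/eqP; rewrite eq_sym eqEdim sMN dM; apply: dmax.
by apply/asboolP; exists N.
Qed.

Fact jacobson_ideal :
  [&& (fullv * jacobson_vs <= jacobson_vs)%VS,
      (jacobson_vs * fullv <= jacobson_vs)%VS & 1 \notin jacobson_vs].
Proof.
apply/and3P; split.
- apply/prodvP=> a x _ /jacobson_vsP xJ; apply/jacobson_vsP=> M maxM.
  by apply: left_idealP; [case: maxM | apply: xJ].
- apply/prodvP=> x a /jacobson_vsP xJ _; apply/jacobson_vsP=> M [lM nM maxM].
  have [aM | aM] := boolP (a \in M); first exact: left_idealP.
  pose N := (linfun (amulr a) @^-1: M)%VS.
  have inN y : (y \in N) = (y * a \in M) by rewrite -memv_preim lfunE /= lfunE.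
  suff maxN : maximal_left_ideal N by rewrite -inN; apply: xJ.
  split.
  + by apply/prodvP=> b y _; rewrite !inN -mulrA; apply: left_idealP.
  + by move=> N1; have := memvf (1 : A); rewrite -N1 inN mul1r (negPf aM).
  move=> L lL sNL nL; apply/eqP; rewrite eqEsubv sNL andbT.
  apply/subvP=> l Ll; rewrite inN; apply/negPn/negP=> laM.
  pose K := (M + linfun (amulr (l * a)) @: fullv)%VS.
  have lK : left_ideal K.
    apply/prodvP=> b y _ /memv_addP[m Mm [_ /memv_imgP[c _ ->] ->]].
    rewrite mulrDr; apply: memv_add; first exact: left_idealP.
    apply/memv_imgP; exists (b * c); rewrite ?memvf //.
    by rewrite !lfunE /= !lfunE /= mulrA.
  have laK : l * a \in K.
    rewrite -[l * a]add0r; apply: memv_add; rewrite ?mem0v //; apply/memv_imgP.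
    by exists 1; rewrite ?memvf // lfunE /= lfunE /= mul1r.
  have K1 : K = fullv.
    case: (K =P fullv) => // nK; case/negP: laM.
    by rewrite -(maxM K lK (addvSl _ _) nK).
  have: a \in K by rewrite K1 memvf.
  case/memv_addP=> m Mm [_ /memv_imgP[b _ ->]]; rewrite lfunE /= lfunE /= => Da.
  have: 1 - b * l \in L.
    apply: (subvP sNL); rewrite inN mulrBl mul1r -mulrA {1}Da.
    by rewrite addrK.
  move/(rpredD (left_idealP lL b Ll)); rewrite addrC subrK.
  exact/negP/one_notin_left_ideal.
- apply/negP=> /jacobson_vsP J1; case: maximal_left_ideal_exists => M maxM.
  case: (maxM) => lM nM _; case/negP: (one_notin_left_ideal lM nM).
  exact: J1.
Qed.

Definition jacobson : tsideal A := TSIdeal jacobson_ideal.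

Definition local_algebra : Prop :=
  forall x : quotalg jacobson, x != 0 -> x \is a GRing.unit.

(* A / J is nonzero, so a product decomposition of it can be taken with at    *)
(* least one factor and with no factor of size 0.                             *)
Definition splitting_field : Prop :=
  exists (n : nat) (d : 'I_n.+1 -> nat),
    alg_iso (quotalg jacobson)
            (prodalg (fun i => 'M[F]_((d i).+1) : algType F)).

End Jacobson.

Section TensorProduct.
Variables (F : fieldType) (A B : falgType F).

(* A \otimes B, carried by coordinates in the basis of the tensors of basis   *)
(* vectors of A and B. tens_bilinear, tens_lift_tens and tens_lift_unique     *)
(* form the universal property, and tensM determines the multiplication.      *)
Definition tensalg : Type := 'M[F]_(\dim {:A}, \dim {:B}).
HB.instance Definition _ := Vector.copy tensalg 'M[F]_(\dim {:A}, \dim {:B}).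

Definition tens (a : A) (b : B) : tensalg :=
  \matrix_(i, j) (coord (vbasis {:A}) i a * coord (vbasis {:B}) j b).

Definition bilinear_map (V : lmodType F) (f : A -> B -> V) : Prop :=
  (forall b, linear (f^~ b)) /\ (forall a, linear (f a)).

Definition tens_lift (V : lmodType F) (f : A -> B -> V) (t : tensalg) : V :=
  \sum_i \sum_j t i j *: f (vbasis {:A})`_i (vbasis {:B})`_j.

Lemma tens_bilinear : bilinear_map tens.
Proof.
split=> [b | a] c x y; apply/matrixP=> i j; rewrite !mxE linearP /=.
  by rewrite mulrDl mulrA.
by rewrite mulrDr mulrCA.
Qed.

Fact tens_lift_is_linear (V : lmodType F) (f : A -> B -> V) :
  linear (tens_lift f).
Proof.
move=> c s t; rewrite /tens_lift scaler_sumr -big_split; apply: eq_bigr => i _.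
rewrite scaler_sumr -big_split; apply: eq_bigr => j _.
by rewrite !mxE scalerDl scalerA.
Qed.
HB.instance Definition _ (V : lmodType F) (f : A -> B -> V) :=
  GRing.isLinear.Build F tensalg V _ (tens_lift f) (tens_lift_is_linear f).

Lemma tens_lift_tens (V : lmodType F) (f : A -> B -> V) :
  bilinear_map f -> forall a b, tens_lift f (tens a b) = f a b.
Proof.
case=> fl fr a b.
pose fL b := GRing.isLinear.Build F A V _ (f^~ b) (fl b).
pose fLb b : {linear A -> V} := HB.pack (f^~ b) (fL b).
pose fR a := GRing.isLinear.Build F B V _ (f a) (fr a).
pose fRa a : {linear B -> V} := HB.pack (f a) (fR a).
have suml b' I r (a_ : I -> F) (x_ : I -> A) :
    f (\sum_(i <- r) a_ i *: x_ i) b' = \sum_(i <- r) a_ i *: f (x_ i) b'.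
  rewrite -[LHS]/(fLb b' _) linear_sum.
  by apply: eq_bigr => i _; rewrite linearZ.
have sumr a' I r (b_ : I -> F) (y_ : I -> B) :
    f a' (\sum_(i <- r) b_ i *: y_ i) = \sum_(i <- r) b_ i *: f a' (y_ i).
  rewrite -[LHS]/(fRa a' _) linear_sum.
  by apply: eq_bigr => i _; rewrite linearZ.
rewrite [in RHS](coord_vbasis (memvf a)) suml; apply: eq_bigr => i _.
rewrite [in RHS](coord_vbasis (memvf b)) sumr scaler_sumr.
by apply: eq_bigr => j _; rewrite mxE scalerA.
Qed.

Lemma tens_sum (t : tensalg) :
  t = \sum_i \sum_j t i j *: tens (vbasis {:A})`_i (vbasis {:B})`_j.
Proof.
rewrite {1}[t]matrix_sum_delta; apply: eq_bigr => i _; apply: eq_bigr => j _.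
congr (_ *: _); apply/matrixP=> k l; rewrite !mxE.
rewrite !coord_free ?(basis_free (vbasisP _)) //.
by rewrite -natrM mulnb [i == k]eq_sym [j == l]eq_sym.
Qed.

Lemma tens_lift_unique (V : lmodType F) (g h : {linear tensalg -> V}) :
  (forall a b, g (tens a b) = h (tens a b)) -> g =1 h.
Proof.
move=> eq_gh t; rewrite [t]tens_sum !linear_sum; apply: eq_bigr => i _.
by rewrite !linear_sum; apply: eq_bigr => j _; rewrite !linearZ eq_gh.
Qed.

Definition tens_one : tensalg := tens 1 1.
Definition tens_mul (s t : tensalg) : tensalg :=
  tens_lift (fun a b => tens_lift (fun a' b' => tens (a * a') (b * b')) t) s.

Let bil_r a b : bilinear_map (fun a' b' => tens (a * a') (b * b')).
Proof.
have [tl tr] := tens_bilinear.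
by split=> [y | x] c u v; rewrite mulrDr -scalerAr ?tl ?tr.
Qed.

Let bil_l t :
  bilinear_map (fun a b => tens_lift (fun a' b' => tens (a * a') (b * b')) t).
Proof.
have [tl tr] := tens_bilinear.
split=> [b | a] c u v; rewrite /tens_lift scaler_sumr -big_split;
  apply: eq_bigr => i _; rewrite scaler_sumr -big_split; apply: eq_bigr => j _;
  by rewrite mulrDl -scalerAl ?tl ?tr scalerDr !scalerA mulrC.
Qed.

Fact tens_mul_linearl t : linear (tens_mul^~ t).
Proof. by move=> c s s'; rewrite /tens_mul linearP. Qed.

Fact tens_mul_linearr s : linear (tens_mul s).
Proof.
move=> c t t'; rewrite /tens_mul {1 3 5}/tens_lift scaler_sumr -big_split.
apply: eq_bigr => i _; rewrite scaler_sumr -big_split; apply: eq_bigr => j _.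
by rewrite linearP scalerDr !scalerA mulrC.
Qed.

Lemma tensM a b a' b' :
  tens_mul (tens a b) (tens a' b') = tens (a * a') (b * b').
Proof. by rewrite /tens_mul tens_lift_tens // tens_lift_tens. Qed.

Let mulL t : {linear tensalg -> tensalg} :=
  HB.pack (tens_mul^~ t)
    (GRing.isLinear.Build F tensalg tensalg _ _ (tens_mul_linearl t)).
Let mulR s : {linear tensalg -> tensalg} :=
  HB.pack (tens_mul s)
    (GRing.isLinear.Build F tensalg tensalg _ _ (tens_mul_linearr s)).

Fact tens_mulA : associative tens_mul.
Proof.
move=> s t u.
apply: (tens_lift_unique (g := mulR s \o mulR t) (h := mulR (tens_mul s t))).
move=> a3 b3 /=; move: t.
apply: (tens_lift_unique (g := mulR s \o mulL (tens a3 b3))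
                         (h := mulL (tens a3 b3) \o mulR s)).
move=> a2 b2 /=; move: s.
apply: (tens_lift_unique (g := mulL (tens_mul (tens a2 b2) (tens a3 b3)))
                         (h := mulL (tens a3 b3) \o mulL (tens a2 b2))).
by move=> a1 b1 /=; rewrite !tensM !mulrA.
Qed.

Fact tens_mul1l : left_id tens_one tens_mul.
Proof.
apply: (tens_lift_unique (g := mulR tens_one) (h := idfun)).
by move=> a b /=; rewrite tensM !mul1r.
Qed.

Fact tens_mul1r : right_id tens_one tens_mul.
Proof.
apply: (tens_lift_unique (g := mulL tens_one) (h := idfun)).
by move=> a b /=; rewrite tensM !mulr1.
Qed.

Fact tens_mulDl : left_distributive tens_mul +%R.
Proof. by move=> s t u; apply: (linearD (mulL u)). Qed.

Fact tens_mulDr : right_distributive tens_mul +%R.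
Proof. by move=> s; apply: (linearD (mulR s)). Qed.

Fact tens_1neq0 : tens_one != 0.
Proof.
have nz (V : falgType F) : exists i, coord (vbasis {:V}) i 1 != 0.
  apply/existsP; rewrite -negb_forall; apply/negP=> /forallP v0.
  have := oner_neq0 V; rewrite (coord_vbasis (memvf 1)) big1 ?eqxx // => i _.
  by rewrite (eqP (v0 i)) scale0r.
have [i nzi] := nz A; have [j nzj] := nz B.
apply/eqP=> /matrixP/(_ i j); rewrite !mxE => /eqP.
by rewrite mulf_eq0 (negPf nzi) (negPf nzj).
Qed.

HB.instance Definition _ := GRing.Zmodule_isNzRing.Build tensalg
  tens_mulA tens_mul1l tens_mul1r tens_mulDl tens_mulDr tens_1neq0.

Fact tens_scaleAl (c : F) (s t : tensalg) : c *: (s * t) = c *: s * t.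
Proof. by rewrite -[RHS]/(mulL t _) linearZ. Qed.
HB.instance Definition _ :=
  GRing.Lmodule_isLalgebra.Build F tensalg tens_scaleAl.

Fact tens_scaleAr (c : F) (s t : tensalg) : c *: (s * t) = s * (c *: t).
Proof. by rewrite -[RHS]/(mulR s _) linearZ. Qed.
HB.instance Definition _ :=
  GRing.Lalgebra_isAlgebra.Build F tensalg tens_scaleAr.

HB.instance Definition _ := Algebra_isFalgebra.Build F tensalg.

End TensorProduct.

(* Main.v *)
(* Write R = A (x) C = B (x) C, and let D be the second copy of C. Modulo     *)
(* rad^2, an element of rad R is the sum of its projections to B and to D, so *)
(* gamma = (C -> B -> C) and delta = (C -> D -> C) add up to the identity on  *)
(* rad C / rad^2 C. Let X be the stable image of gamma, as in Fitting's       *)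
(* lemma. With Q the quotient of C by the ideal generated by rad X, the       *)
(* algebra R maps to X (x) Q through B -> C -> X and D -> C -> Q; restricted  *)
(* to C this is onto modulo rad^2, hence onto by Nakayama, and a dimension    *)
(* count makes it an isomorphism C = X (x) Q. By symmetry B = X (x) Q'. If X  *)
(* = F, then delta is an automorphism, and exchanging C for D gives A = B.    *)
(* Otherwise exchanging the two copies of X gives A (x) Q = Q' (x) C = B (x)  *)
(* Q with Q smaller than C, and we conclude by induction on the dimension of  *)
(* C.                                                                         *)
From HB Require Import structures.
Require Import Defs.
From mathcomp Require Import all_boot all_order all_algebra all_field.
From mathcomp Require Import boolp.

Set Implicit Arguments.
Unset Strict Implicit.
Unset Printing Implicit Defensive.

Import GRing.Theory.
Local Open Scope ring_scope.

(** A local algebra split by F is F plus a nilpotent radical ([augalg_of_local]), so a morphism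
    between such algebras is onto as soon as it is onto between radicals modulo their squares
    ([surj_mod_arad2]), and it is bijective if moreover the dimensions agree. Modulo squares a
    tensor product becomes a direct sum ([tensor_tangent]), and comparing two decompositions of one
    R becomes a question about block matrices ([tensor_exchange]): if the map from one copy of C to
    the other is onto, then so is the map from A to B. The obstruction is the part of C on which the
    passage through B and back is invertible. [fitting] isolates it as X, and [split_tensor] shows
    that X is a tensor factor of both C and B. [tensor_cancel] removes X and continues with its
    complement in C. *)

(** * Linear maps and algebra morphisms *)

Section Morphisms.
Variable F : fieldType.

Lemma lrmorphism_inv (A B : algType F) (f : {lrmorphism A -> B}) :
  bijective f -> exists2 g : {lrmorphism B -> A}, cancel f g & cancel g f.
Proof.
case=> g fK gK; have finj := can_inj fK.
have g_linear : linear g.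
  by move=> a x y; apply: finj; rewrite gK linearP /= !gK.
have g_mul : monoid_morphism g.
  split=> [|x y]; first by apply: finj; rewrite [LHS]gK rmorph1.
  by apply: finj; rewrite [LHS]gK rmorphM /= !gK.
pose g' : {lrmorphism B -> A} := HB.pack g
  (GRing.isLinear.Build F B A _ g g_linear)
  (GRing.isMonoidMorphism.Build B A g g_mul).
by exists g'.
Qed.

Lemma memv_linfun (U V : vectType F) (f : {linear U -> V}) (W : {vspace U}) x :
  x \in W -> f x \in (linfun f @: W)%VS.
Proof. by move=> Wx; rewrite -(lfunE f) memv_img. Qed.

Lemma linear_surj_bij (U V : vectType F) (f : {linear U -> V}) :
  \dim {:U} = \dim {:V} -> (forall y, exists x, f x = y) -> bijective f.
Proof.
move=> dimUV f_surj.
have f_full : limg (linfun f) = fullv.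
  apply/vspaceP=> y; rewrite memvf; have [x <-] := f_surj y.
  by rewrite -[f x](lfunE f) memv_img ?memvf.
have ker0 : lker (linfun f) == 0%VS.
  rewrite -dimv_eq0; have := limg_ker_dim (linfun f) fullv.
  rewrite f_full capfv dimUV -[X in _ = X]add0n => /addIn ->.
  exact: eqxx.
exists (linfun f)^-1%VF => x; rewrite -[f _](lfunE f).
  by rewrite lker0_lfunK.
by rewrite limg_lfunVK // f_full memvf.
Qed.

Lemma linear_inj_bij (U : vectType F) (f : {linear U -> U}) :
  injective f -> bijective f.
Proof.
move=> finj; have ker0 : lker (linfun f) == 0%VS.
  by apply/lker0P=> x y; rewrite !lfunE; apply: finj.
exists (linfun f)^-1%VF => x; rewrite -[f _](lfunE f).
  by rewrite lker0_lfunK.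
by rewrite lker0_lfunVK.
Qed.

Lemma alg_iso_surj (A B : falgType F) (f : {lrmorphism A -> B}) :
  \dim {:A} = \dim {:B} -> (forall y, exists x, f x = y) -> alg_iso A B.
Proof. by move=> dAB fs; exists f; apply: linear_surj_bij. Qed.

Lemma alg_iso_dim (A B : falgType F) : alg_iso A B -> \dim {:A} = \dim {:B}.
Proof.
case=> f [g fK gK]; have ker0 : (fullv :&: lker (linfun f) = 0)%VS.
  by apply/eqP; rewrite capfv; apply/lker0P=> x y; rewrite !lfunE; apply: can_inj fK _ _.
rewrite -(limg_dim_eq ker0); congr (\dim _); apply/vspaceP=> y.
by rewrite memvf -[y]gK -[f _](lfunE f) memv_img ?memvf.
Qed.

End Morphisms.

(** * Augmented algebras *)

(* A local algebra with residue field F, given by its augmentation. *)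
Record augalg (F : fieldType) := AugAlg {
  aug_alg :> falgType F;
  eps : {lrmorphism aug_alg -> F^o};
  eps_nil : exists n, (lker (linfun eps) ^+ n = 0)%VS }.

Section Augmented.
Variable F : fieldType.
Implicit Types A B C : augalg F.

Definition arad A : {vspace A} := lker (linfun (eps A)).

Lemma mem_arad A (x : A) : (x \in arad A) = (eps A x == 0).
Proof. by rewrite memv_ker lfunE. Qed.

Lemma arad_nil A : exists n, (arad A ^+ n = 0)%VS.
Proof. exact: eps_nil. Qed.

Lemma eps_scale A (c : F) : eps A (c *: 1) = c.
Proof. by rewrite linearZ /= rmorph1; apply: mulr1. Qed.

Lemma arad_sub_eps A (x : A) : x - eps A x *: 1 \in arad A.
Proof. by rewrite mem_arad linearB /= eps_scale subrr. Qed.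

Lemma aradMl A (x y : A) : y \in arad A -> x * y \in arad A.
Proof. by rewrite !mem_arad rmorphM /= => /eqP->; rewrite mulr0. Qed.

Lemma aradMr A (x y : A) : x \in arad A -> x * y \in arad A.
Proof. by rewrite !mem_arad rmorphM /= => /eqP->; rewrite mul0r. Qed.

Lemma one_notin_arad A : 1 \notin arad A.
Proof. by rewrite mem_arad rmorph1 oner_eq0. Qed.

Lemma arad_expr A (x : A) : x \in arad A -> exists n, x ^+ n = 0.
Proof.
have [n Jn] := arad_nil A; move=> Jx; exists n; apply/eqP.
rewrite -memv0 -Jn; elim: n {Jn} => [|n IHn]; first by rewrite expv0 memv_line.
by rewrite exprS expvSl memv_mul.
Qed.

(** Every algebra morphism respects augmentations: [x - eps A x *: 1] is nilpotent, so its image in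
    F is nilpotent, hence 0. *)
Lemma eps_morph A B (f : {lrmorphism A -> B}) x : eps B (f x) = eps A x.
Proof.
have [n xn] := arad_expr (arad_sub_eps x).
have /eqP : eps B (f (x - eps A x *: 1)) ^+ n = 0.
  by rewrite -!rmorphXn xn !rmorph0.
rewrite expf_eq0 => /andP[_].
by rewrite !linearB /= linearZ /= rmorph1 eps_scale subr_eq0 => /eqP.
Qed.

Lemma arad_morph A B (f : {lrmorphism A -> B}) x : (f x \in arad B) = (x \in arad A).
Proof. by rewrite !mem_arad eps_morph. Qed.

Definition arad2 A : {vspace A} := (arad A * arad A)%VS.

Lemma arad2_morph A B (f : {lrmorphism A -> B}) x : x \in arad2 A -> f x \in arad2 B.
Proof.
rewrite -[f x](lfunE f) memv_preim; apply/subvP/prodvP=> a b Ja Jb.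
by rewrite -memv_preim lfunE rmorphM memv_mul ?arad_morph.
Qed.

(** Nakayama's lemma for subalgebras: multiplying approximations shows that S covers each power of
    the radical modulo the next one, and the powers end at 0. *)
Lemma subalg_full A (S : {vspace A}) : 1 \in S -> (S * S <= S)%VS ->
    (forall y, y \in arad A -> exists2 s, s \in S & y - s \in arad2 A) ->
  S = fullv.
Proof.
move=> S1 /prodvP SS gen.
have step k : (arad A ^+ k.+1 <= S :&: arad A ^+ k.+1 + arad A ^+ k.+2)%VS.
  elim: k => [|k IHk].
    apply/subvP=> y; rewrite expv1 => Jy; have [s Ss Js2] := gen y Jy.
    rewrite -[y](subrK s) addrC memv_add // memv_cap Ss -[s](subKr y).
    apply: rpredB => //; apply: subvP Js2; apply/prodvP=> a b _.
    exact: aradMl.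
  rewrite {1}expvSl; apply/prodvP=> a b.
  move=> Ja /(subvP IHk)/memv_addP[s /memv_capP[Ss Js] [z Jz ->]].
  have [t St Jt] := gen a Ja; rewrite mulrDr -{1}[a](subrK t) mulrDl.
  have Jt' : t \in arad A.
    rewrite -[t](subKr a) rpredB //; apply: subvP Jt; apply/prodvP=> u v _.
    exact: aradMl.
  rewrite [_ + t * s]addrC -addrA memv_add //.
    by rewrite memv_cap SS // expvSl memv_mul.
  apply: memvD; last by rewrite expvSl memv_mul.
  by rewrite 2!expvSl prodvA memv_mul.
have [n Jn] := arad_nil A.
have JS : (arad A <= S)%VS.
  suff: (arad A <= S + arad A ^+ n.+1)%VS.
    by rewrite expvSl Jn prodv0 addv0.
  elim: n {Jn} => [|k IHk]; first by rewrite expv1 addvSr.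
  apply: subv_trans IHk _; rewrite subv_add addvSl.
  by apply: subv_trans (step k) _; rewrite addvS ?capvSl.
apply/vspaceP=> x; rewrite memvf -[x](subrK (eps A x *: 1)) rpredD ?rpredZ //.
exact: subvP JS _ (arad_sub_eps x).
Qed.

Lemma surj_mod_arad2 A B (f : {lrmorphism A -> B}) :
    (forall y, y \in arad B -> exists x, y - f x \in arad2 B) ->
  forall y, exists x, f x = y.
Proof.
move=> gen y; have: y \in limg (linfun f).
  rewrite [limg _]subalg_full ?memvf //.
  - by apply/memv_imgP; exists 1; rewrite ?memvf // lfunE /= rmorph1.
  - apply/prodvP=> _ _ /memv_imgP[a _ ->] /memv_imgP[b _ ->].
    by apply/memv_imgP; exists (a * b); rewrite ?memvf // !lfunE /= rmorphM.
  move=> z /gen[x Jx]; exists (f x) => //.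
  by rewrite -[f x](lfunE f) memv_img ?memvf.
by case/memv_imgP=> x _ ->; exists x; rewrite lfunE.
Qed.

End Augmented.

(** * Quotients of augmented algebras *)

Lemma lrmorphism_factor (F : fieldType) (A Q : falgType F) (B : algType F)
    (pi : {lrmorphism A -> Q}) (f : {lrmorphism A -> B}) :
    (forall q, exists x, pi x = q) -> (forall x, pi x = 0 -> f x = 0) ->
  exists g : {lrmorphism Q -> B}, forall x, g (pi x) = f x.
Proof.
move=> pi_surj ker_pi; pose g q := f ((linfun pi)^-1%VF q).
have gE x : g (pi x) = f x.
  apply/eqP; rewrite -subr_eq0 -linearB; apply/eqP/ker_pi.
  apply/eqP; rewrite linearB subr_eq0 -!(lfunE pi) limg_lfunVK //.
  by rewrite memv_img ?memvf.
have g_linear : linear g.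
  move=> a x y; have [[u <-] [v <-]] := (pi_surj x, pi_surj y).
  by rewrite -linearP !gE linearP.
have g_mul : monoid_morphism g.
  split=> [|x y]; first by rewrite -[X in g X](rmorph1 pi) gE rmorph1.
  have [[u <-] [v <-]] := (pi_surj x, pi_surj y).
  by rewrite -rmorphM !gE rmorphM.
pose g' : {lrmorphism Q -> B} := HB.pack g
  (GRing.isLinear.Build F Q B _ g g_linear)
  (GRing.isMonoidMorphism.Build Q B g g_mul).
by exists g'.
Qed.

Lemma augalg_quotient (F : fieldType) (A : augalg F) (I : {vspace A}) :
    (fullv * I <= I)%VS -> (I * fullv <= I)%VS -> 1 \notin I ->
  exists (Q : augalg F) (pi : {lrmorphism A -> Q}),
    (forall q, exists x, pi x = q) /\ (forall x, (pi x == 0) = (x \in I)).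
Proof.
move=> AI IA nI1.
have idI : [&& (fullv * I <= I)%VS, (I * fullv <= I)%VS & 1 \notin I].
  exact/and3P.
pose Q0 := quotalg (TSIdeal idI).
pose pi : {lrmorphism A -> Q0} := @quot_pi F A (TSIdeal idI).
have pi_surj : forall q, exists x, pi x = q by apply: quot_pi_surj.
have pi0 x : (pi x == 0) = (x \in I) by apply: quot_pi_eq0.
have [e eE] : exists e : {lrmorphism Q0 -> F^o}, forall x, e (pi x) = eps A x.
  apply: lrmorphism_factor => // x /eqP; rewrite pi0 => Ix.
  (* [x - eps A x *: 1] is nilpotent, and for x in I its image is the scalar [- eps A x]; since I is
     proper this scalar must vanish. *)
  have [n xn] := arad_expr (arad_sub_eps x).
  have /eqP : pi (x - eps A x *: 1) ^+ n = 0 by rewrite -rmorphXn xn rmorph0.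
  have /eqP pix : pi x == 0 by rewrite pi0.
  rewrite linearB /= pix sub0r linearZ /= rmorph1 -scaleNr exprZn expr1n.
  by rewrite scaler_eq0 oner_eq0 orbF expf_eq0 oppr_eq0 => /andP[_ /eqP].
have [n Jn] := arad_nil A.
have nilQ : exists n, (lker (linfun e) ^+ n = 0)%VS.
  exists n; apply/eqP; rewrite -subv0.
  have -> : lker (linfun e) = (linfun pi @: arad A)%VS.
    apply/vspaceP=> q; rewrite memv_ker lfunE /=; apply/idP/memv_imgP.
      have [x <-] := pi_surj q; rewrite eE -mem_arad => Jx.
      by exists x; rewrite ?lfunE.
    by case=> x Jx ->; rewrite lfunE /= eE -mem_arad.
  suff -> : (linfun pi @: arad A ^+ n = linfun pi @: (arad A ^+ n))%VS.
    by rewrite Jn limg0.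
  have pi_hom : ahom_in fullv (linfun pi).
    by apply/ahomP_tmp; split=> [|x y]; rewrite !lfunE ?rmorph1 ?rmorphM.
  exact/esym/(aimgX (AHom pi_hom)).
by exists (AugAlg nilQ), pi.
Qed.

(** * Tensor products *)

Section TensorMorphisms.
Variables (F : fieldType) (A C : falgType F).

Lemma tens_mulE a c a' c' :
  tens a c * tens a' c' = tens (a * a') (c * c') :> tensalg A C.
Proof. exact: tensM. Qed.

Lemma tens_mem (W : {vspace tensalg A C}) :
  (forall a c, tens a c \in W) -> forall t, t \in W.
Proof.
move=> Wt t; rewrite [t]tens_sum.
by apply: rpred_sum => i _; apply: rpred_sum => j _; apply: rpredZ.
Qed.

(** The two sides of the multiplicativity identity are bilinear, so it is checked on pure tensors,
    one argument at a time; there it is the commutation of the two images. *)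
Lemma tens_morph (S : falgType F) (f : {lrmorphism A -> S})
    (g : {lrmorphism C -> S}) :
    (forall a c, f a * g c = g c * f a) ->
  exists h : {lrmorphism tensalg A C -> S}, forall a c, h (tens a c) = f a * g c.
Proof.
move=> comm_fg; pose fg a c := f a * g c.
have fg_bil : bilinear_map fg.
  split=> [c | a] k x y; rewrite /fg linearP /=.
    by rewrite mulrDl scalerAl.
  by rewrite mulrDr scalerAr.
pose h : {linear tensalg A C -> S} := @tens_lift F A C S fg.
have hE a c : h (tens a c) = f a * g c by apply: tens_lift_tens.
have h_mul : monoid_morphism h.
  split=> [|s t]; first by rewrite [LHS]hE !rmorph1 mulr1.
  have hl t' : linear (fun s => h (s * t')).
    by move=> k u v; rewrite mulrDl -scalerAl linearP.
  have hr s' : linear (fun t => h (s' * t)).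
    by move=> k u v; rewrite mulrDr -scalerAr linearP.
  have ml t' : linear (fun s => h s * h t').
    by move=> k u v; rewrite linearP mulrDl -scalerAl.
  have mr s' : linear (fun t => h s' * h t).
    by move=> k u v; rewrite linearP mulrDr -scalerAr.
  pose pack (k : tensalg A C -> S) (kl : linear k) : {linear tensalg A C -> S} :=
    HB.pack k (GRing.isLinear.Build F _ S _ k kl).
  apply: (tens_lift_unique (g := pack _ (hl t)) (h := pack _ (ml t))) => a c.
  apply: (tens_lift_unique (g := pack _ (hr (tens a c)))
                           (h := pack _ (mr (tens a c)))) => a' c' /=.
  rewrite tens_mulE !hE !rmorphM -!mulrA; congr (_ * _).
  by rewrite !mulrA comm_fg.
pose h' : {lrmorphism tensalg A C -> S} := HB.pack (h : tensalg A C -> S)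
  (GRing.isLinear.Build F (tensalg A C) S _ h (linearP h))
  (GRing.isMonoidMorphism.Build (tensalg A C) S h h_mul).
by exists h'.
Qed.

Lemma tens_inl : exists i : {lrmorphism A -> tensalg A C}, forall a, i a = tens a 1.
Proof.
pose f a : tensalg A C := tens a 1.
have f_linear : linear f by move=> k x y; apply: (tens_bilinear _ _).1.
have f_mul : monoid_morphism f by split=> // x y; rewrite /f tens_mulE mulr1.
pose f' : {lrmorphism A -> tensalg A C} := HB.pack f
  (GRing.isLinear.Build F A _ _ f f_linear)
  (GRing.isMonoidMorphism.Build A (tensalg A C) f f_mul).
by exists f'.
Qed.

Lemma tens_inr : exists j : {lrmorphism C -> tensalg A C}, forall c, j c = tens 1 c.
Proof.
pose f c : tensalg A C := tens 1 c.
have f_linear : linear f by move=> k x y; apply: (tens_bilinear _ _).2.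
have f_mul : monoid_morphism f by split=> // x y; rewrite /f tens_mulE mulr1.
pose f' : {lrmorphism C -> tensalg A C} := HB.pack f
  (GRing.isLinear.Build F C _ _ f f_linear)
  (GRing.isMonoidMorphism.Build C (tensalg A C) f f_mul).
by exists f'.
Qed.

Lemma dim_tensalg : \dim {:tensalg A C} = (\dim {:A} * \dim {:C})%N.
Proof. by rewrite [LHS]dimvf dim_matrix. Qed.

End TensorMorphisms.

(** * Nilpotency of the radical of a tensor product *)

Section NilpotentSum.
Variables (F : fieldType) (T : falgType F).

Lemma expv_limg (A : falgType F) (f : {lrmorphism A -> T}) (U : {vspace A}) n :
  (linfun f @: U ^+ n = linfun f @: (U ^+ n))%VS.
Proof.
have f_hom : ahom_in fullv (linfun f).
  by apply/ahomP_tmp; split=> [|x y]; rewrite !lfunE ?rmorph1 ?rmorphM.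
exact/esym/(aimgX (AHom f_hom)).
Qed.

Lemma full_expv (a : {vspace T}) k :
  (fullv * a <= a * fullv)%VS -> (fullv * a ^+ k <= a ^+ k * fullv)%VS.
Proof.
move=> fa; elim: k => [|k IHk]; first by rewrite expv0 prodv1 prod1v.
rewrite expvSl prodvA -(prodvA a); apply: subv_trans (prodvSr a IHk).
by rewrite prodvA prodvSl.
Qed.

(** By normality the factors from [a] can be collected on the left, so N^n lies in a^n T + cT = cT.
    Likewise (cT)^m lies in c^m T = 0, whence the exponent nm. *)
Lemma nilpotent_sum (a c N : {vspace T}) n m :
    (fullv * a <= a * fullv)%VS -> (fullv * c <= c * fullv)%VS ->
    (a ^+ n = 0)%VS -> (c ^+ m = 0)%VS -> (N <= a * fullv + c * fullv)%VS ->
  exists k, (N ^+ k = 0)%VS.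
Proof.
move=> fa fc an cm sN.
have ff : ({:T} * fullv <= fullv)%VS by apply: subvf.
have Nn k : (N ^+ k <= a ^+ k * fullv + c * fullv)%VS.
  elim: k => [|k IHk].
    by rewrite !expv0 prod1v; apply: subv_trans (subvf _) (addvSl _ _).
  rewrite expvSl; apply: subv_trans (prodvS sN IHk) _.
  rewrite prodvDl !prodvDr !subv_add -andbA; apply/and4P; split.
  - apply: subv_trans (addvSl _ _); rewrite expvSl -!prodvA prodvSr //.
    rewrite prodvA; apply: subv_trans (prodvSl _ (full_expv k fa)) _.
    by rewrite -prodvA prodvSr.
  - apply: subv_trans (addvSr _ _).
    rewrite prodvA; apply: (@subv_trans _ _ (fullv * c * fullv)%VS).
      by rewrite prodvSl // prodvSl // subvf.
    by apply: subv_trans (prodvSl _ fc) _; rewrite -prodvA prodvSr.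
  - by apply: subv_trans (addvSr _ _); rewrite -prodvA prodvSr // subvf.
  - by apply: subv_trans (addvSr _ _); rewrite -prodvA prodvSr // subvf.
have cf k : ((c * fullv) ^+ k <= c ^+ k * fullv)%VS.
  elim: k => [|k IHk]; first by rewrite !expv0 prod1v subvf.
  rewrite expvSl; apply: subv_trans (prodvSr _ IHk) _.
  rewrite expvSl -!prodvA prodvSr // prodvA.
  by apply: subv_trans (prodvSl _ (full_expv k fc)) _; rewrite -prodvA prodvSr.
exists (n * m)%N; apply/eqP; rewrite -subv0 expvM.
have := Nn n; rewrite an prod0v add0v => /(expvS m) /subv_trans; apply.
by apply: subv_trans (cf m) _; rewrite cm prod0v.
Qed.

End NilpotentSum.

Section AugTensor.
Variable F : fieldType.
Implicit Types A B C R S X Q : augalg F.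

Lemma const_morph C (S : falgType F) :
  exists f : {lrmorphism C -> S}, forall c, f c = eps C c *: 1.
Proof.
pose f c : S := eps C c *: 1.
have f_linear : linear f by move=> k x y; rewrite /f linearP scalerDl scalerA.
have f_mul : monoid_morphism f.
  split=> [|x y]; first by rewrite /f rmorph1 scale1r.
  by rewrite /f rmorphM -scalerAl mul1r scalerA.
pose f' : {lrmorphism C -> S} := HB.pack f
  (GRing.isLinear.Build F C _ _ f f_linear)
  (GRing.isMonoidMorphism.Build C S f f_mul).
by exists f'.
Qed.

(** The kernel of the product augmentation is generated by the radicals of the two factors, to which
    [nilpotent_sum] applies. An equality of [falgType]s, not an isomorphism, is given so that T can
    be replaced by [tensalg A C] by rewriting. *)
Lemma augalg_tens A C : exists T : augalg F, aug_alg T = tensalg A C :> falgType F.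
Proof.
have [e eE] : exists e : {lrmorphism tensalg A C -> F^o},
    forall a c, e (tens a c) = eps A a * eps C c.
  by apply: tens_morph => a c; apply: mulrC.
suff nilT : exists n, (lker (linfun e) ^+ n = 0)%VS by exists (AugAlg nilT).
have [i iE] := tens_inl A C; have [j jE] := tens_inr A C.
have [[n An] [m Cm]] := (arad_nil A, arad_nil C).
apply: (@nilpotent_sum _ _ (linfun i @: arad A)%VS (linfun j @: arad C)%VS _ n m).
- apply/prodvP=> t _ _ /memv_imgP[x Jx ->]; rewrite lfunE /= iE.
  have: t \in (linfun (amulr (tens x 1)) @^-1: (linfun i @: arad A * fullv))%VS.
    apply: tens_mem => a c.
    rewrite -memv_preim !lfunE /= !lfunE /= tens_mulE mulr1.
    have -> : tens (a * x) c = i (a * x) * j c by rewrite iE jE tens_mulE mulr1 mul1r.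
    by rewrite memv_mul ?memvf // -(lfunE i) memv_img // aradMl.
  by rewrite -memv_preim !lfunE /= !lfunE.
- apply/prodvP=> t _ _ /memv_imgP[x Jx ->]; rewrite lfunE /= jE.
  have: t \in (linfun (amulr (tens 1 x)) @^-1: (linfun j @: arad C * fullv))%VS.
    apply: tens_mem => a c.
    rewrite -memv_preim !lfunE /= !lfunE /= tens_mulE mulr1.
    have -> : tens a (c * x) = j (c * x) * i a by rewrite iE jE tens_mulE mulr1 mul1r.
    by rewrite memv_mul ?memvf // -(lfunE j) memv_img // aradMl.
  by rewrite -memv_preim !lfunE /= !lfunE.
- by rewrite expv_limg An limg0.
- by rewrite expv_limg Cm limg0.
apply/subvP=> t; rewrite memv_ker lfunE /= => /eqP et.
(* Subtracting the augmentation turns a claim about the kernel into a linear claim about all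
   tensors, which can be checked on pure ones. *)
have [k kE] : exists k : {linear tensalg A C -> tensalg A C},
    forall t, k t = t - e t *: (1 : tensalg A C).
  pose k (t : tensalg A C) : tensalg A C := t - e t *: (1 : tensalg A C).
  have kl : linear k.
    move=> c u v; rewrite /k linearP scalerBr scalerDl scalerA opprD.
    by rewrite addrACA.
  pose k' : {linear tensalg A C -> tensalg A C} :=
    HB.pack k (GRing.isLinear.Build F _ _ _ k kl).
  by exists k'.
have: t \in (linfun k @^-1: (linfun i @: arad A * fullv + linfun j @: arad C * fullv))%VS.
  apply: tens_mem => a c.
  rewrite -memv_preim lfunE /= kE eE.
  have -> : tens a c - (eps A a * eps C c : F) *: (1 : tensalg A C) =
      i (a - eps A a *: 1) * j c + j (c - eps C c *: 1) * (eps A a *: (1 : tensalg A C)).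
    rewrite (linearB i) (linearB j) /= [i (_ *: _)]linearZ [j (_ *: _)]linearZ /=.
    rewrite !rmorph1 mulrBl mulrBl -!scalerAl mul1r.
    rewrite -!scalerAr mulr1 scalerA iE jE tens_mulE mulr1 mul1r.
    by rewrite addrA subrK mulr1 [in RHS]mulrC.
  apply: memv_add; rewrite memv_mul ?memvf //.
    by rewrite -(lfunE i) memv_img // arad_sub_eps.
  by rewrite -(lfunE j) memv_img // arad_sub_eps.
by rewrite -memv_preim lfunE /= kE et scale0r subr0.
Qed.
End AugTensor.

(* R is the tensor product of A and C along i and j; the projections p and q  *)
(* kill the radical of the other factor.                                      *)
Record tensor_dec (F : fieldType) (R A C : augalg F)
    (i : {lrmorphism A -> R}) (j : {lrmorphism C -> R})
    (p : {lrmorphism R -> A}) (q : {lrmorphism R -> C}) : Prop := TensorDec {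
  td_comm : forall a c, i a * j c = j c * i a;
  td_ind : forall W : {vspace R}, (forall a c, i a * j c \in W) ->
    forall t, t \in W;
  td_dim : \dim {:R} = (\dim {:A} * \dim {:C})%N;
  td_pi : forall a, p (i a) = a;
  td_pj : forall c, p (j c) = eps C c *: 1;
  td_qi : forall a, q (i a) = eps A a *: 1;
  td_qj : forall c, q (j c) = c }.

(** * Internal tensor decompositions *)

Section TensorDec.
Variable F : fieldType.
Implicit Types A B C D R S X Q : augalg F.

Section Universal.
Variables (R A C : augalg F).
Variables (i : {lrmorphism A -> R}) (j : {lrmorphism C -> R}).
Hypothesis ij_comm : forall a c, i a * j c = j c * i a.
Hypothesis ij_ind : forall W : {vspace R}, (forall a c, i a * j c \in W) ->
  forall t, t \in W.

Lemma tensor_ext (S : falgType F) (f g : {lrmorphism R -> S}) :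
  (forall a, f (i a) = g (i a)) -> (forall c, f (j c) = g (j c)) -> f =1 g.
Proof.
move=> fgi fgj t.
have : t \in lker (linfun f - linfun g).
  apply: ij_ind => a c; apply/eqlfunP.
  by rewrite !lfunE /= !rmorphM /= fgi fgj.
by move/eqlfunP; rewrite !lfunE.
Qed.

Hypothesis ij_dim : \dim {:R} = (\dim {:A} * \dim {:C})%N.

(** The concrete tensor product maps onto R by the spanning hypothesis, hence bijectively by
    dimension; its universal property is carried along the inverse. *)
Lemma tensor_univ (S : falgType F) (f : {lrmorphism A -> S})
    (g : {lrmorphism C -> S}) :
    (forall a c, f a * g c = g c * f a) ->
  exists h : {lrmorphism R -> S},
    (forall a, h (i a) = f a) /\ (forall c, h (j c) = g c).
Proof.
move=> fg_comm; have [h hE] := tens_morph fg_comm.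
have [m mE] := tens_morph ij_comm.
have m_surj y : exists x, m x = y.
  have /memv_imgP[x _ ->] : y \in limg (linfun m).
    apply: ij_ind => a c; apply/memv_imgP; exists (tens a c); first exact: memvf.
    by rewrite lfunE /= mE.
  by exists x; rewrite lfunE.
have m_bij : bijective m.
  by apply: linear_surj_bij => //; rewrite ij_dim dim_tensalg.
have [n mK nK] := lrmorphism_inv m_bij.
exists (h \o n); split=> [a | c] /=.
  have -> : i a = m (tens a 1) by rewrite mE rmorph1 mulr1.
  by rewrite mK hE rmorph1 mulr1.
have -> : j c = m (tens 1 c) by rewrite mE rmorph1 mul1r.
by rewrite mK hE rmorph1 mul1r.
Qed.

Lemma tensor_dec_intro : exists p q, tensor_dec i j p q.
Proof.
have [cA cAE] := const_morph A C; have [cC cCE] := const_morph C A.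
have [p [pi pj]] : exists p : {lrmorphism R -> A},
    (forall a, p (i a) = a) /\ (forall c, p (j c) = cC c).
  apply: (tensor_univ (f := idfun)) => a c /=.
  by rewrite cCE -scalerAl -scalerAr mulr1 mul1r.
have [q [qi qj]] : exists q : {lrmorphism R -> C},
    (forall a, q (i a) = cA a) /\ (forall c, q (j c) = c).
  apply: (tensor_univ (g := idfun)) => a c /=.
  by rewrite cAE -scalerAl -scalerAr mulr1 mul1r.
by exists p, q; split=> // [c | a]; rewrite ?pj ?qi.
Qed.

End Universal.

Lemma tensor_dec_sym R A C (i : {lrmorphism A -> R}) (j : {lrmorphism C -> R})
    (p : {lrmorphism R -> A}) (q : {lrmorphism R -> C}) :
  tensor_dec i j p q -> tensor_dec j i q p.
Proof.
case=> ij_comm ij_ind ij_dim pi pj qi qj; split=> //; last by rewrite mulnC.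
by move=> W Wji; apply: ij_ind => a c; rewrite ij_comm.
Qed.

Lemma tensor_exists A C : exists (T : augalg F) (i : {lrmorphism A -> T})
    (j : {lrmorphism C -> T}) (p : {lrmorphism T -> A}) (q : {lrmorphism T -> C}),
  tensor_dec i j p q /\ aug_alg T = tensalg A C :> falgType F.
Proof.
have [[T e nilT] /= eqT] := augalg_tens A C; subst T.
pose T := AugAlg nilT; have [i iE] := tens_inl A C; have [j jE] := tens_inr A C.
have [p [q pq]] : exists p q, @tensor_dec F T A C i j p q.
  apply: tensor_dec_intro => [a c | W Wij t | ].
  - by rewrite iE jE [LHS]tens_mulE [RHS]tens_mulE !mul1r !mulr1.
  - apply: tens_mem => a c; have := Wij a c.
    by rewrite iE jE [_ * _]tens_mulE mulr1 mul1r.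
  - exact: dim_tensalg.
by exists T, i, j, p, q.
Qed.

Lemma tensor_dec_iso R R' A C (i : {lrmorphism A -> R}) (j : {lrmorphism C -> R})
    (p : {lrmorphism R -> A}) (q : {lrmorphism R -> C}) :
    tensor_dec i j p q -> alg_iso R R' ->
  exists (i' : {lrmorphism A -> R'}) (j' : {lrmorphism C -> R'}) p' q',
    tensor_dec i' j' p' q'.
Proof.
case=> ij_comm ij_ind ij_dim _ _ _ _ isoR; have [f f_bij] := isoR.
exists (f \o i), (f \o j); apply: tensor_dec_intro => [a c | W Wij t | ] /=.
- by rewrite -!rmorphM ij_comm.
- have [g fK gK] := f_bij; rewrite -[t]gK -(lfunE f) memv_preim.
  apply: ij_ind => a c; rewrite -memv_preim lfunE /= rmorphM; exact: Wij.
- by rewrite -(alg_iso_dim isoR).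
Qed.

(** For t = i(a) j(b), the element t - i(p t) - j(q t) + eps(t) equals (i(a) - eps(a)) (j(b) -
    eps(b)), a product of two radical elements. The term eps(t), zero on the radical, makes the
    claim linear on all of R. *)
Lemma tensor_tangent R A C (i : {lrmorphism A -> R}) (j : {lrmorphism C -> R})
    (p : {lrmorphism R -> A}) (q : {lrmorphism R -> C}) :
    tensor_dec i j p q ->
  forall t, t \in arad R -> t - (i (p t) + j (q t)) \in arad2 R.
Proof.
move=> [ij_comm ij_ind _ pi pj qi qj] t; rewrite mem_arad => /eqP et.
have [c cE] := const_morph R R.
pose K := (\1 - (linfun (i \o p) + linfun (j \o q)) + linfun c)%VF.
have KE x : K x = x - (i (p x) + j (q x)) + eps R x *: 1.
  by rewrite !(add_lfunE, opp_lfunE) id_lfunE !lfunE /= cE.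
have : t \in (K @^-1: arad2 R)%VS; last first.
  by rewrite -memv_preim KE et scale0r addr0.
apply: ij_ind => a b; rewrite -memv_preim KE !rmorphM /= pi pj qi qj !eps_morph.
rewrite [i (_ *: _)]linearZ [j (_ *: _)]linearZ /= !rmorph1.
rewrite -scalerAr mulr1 -scalerAl mul1r.
have -> : i a * j b - (eps C b *: i a + eps A a *: j b) + (eps A a * eps C b : F) *: 1 =
    (i a - eps A a *: 1) * (j b - eps C b *: 1).
  rewrite mulrBl !mulrBr -!scalerAr !mulr1 -scalerAl mul1r scalerA opprB.
  by rewrite opprD !addrA [RHS]addrAC [eps C b * _]mulrC.
by apply: memv_mul; [rewrite -(eps_morph i) | rewrite -(eps_morph j)]; apply: arad_sub_eps.
Qed.

(** With C = X (x) Q and S = A (x) Q, this regroups A (x) C as X (x) S. The projection to X is fixed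
    as [pX \o qC] because the cancellation argument computes with it. *)
Lemma tensor_dec_assoc R S A C X Q
    (iA : {lrmorphism A -> R}) (jC : {lrmorphism C -> R})
    (pA : {lrmorphism R -> A}) (qC : {lrmorphism R -> C})
    (iX : {lrmorphism X -> C}) (jQ : {lrmorphism Q -> C})
    (pX : {lrmorphism C -> X}) (qQ : {lrmorphism C -> Q})
    (iS : {lrmorphism A -> S}) (jS : {lrmorphism Q -> S})
    (pS : {lrmorphism S -> A}) (qS : {lrmorphism S -> Q}) :
    tensor_dec iA jC pA qC -> tensor_dec iX jQ pX qQ -> tensor_dec iS jS pS qS ->
  exists (j : {lrmorphism S -> R}) (q : {lrmorphism R -> S}),
    tensor_dec (jC \o iX) j (pX \o qC) q.
Proof.
move=> [AC_comm AC_ind AC_dim pAi pAj qCi qCj].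
move=> [XQ_comm XQ_ind XQ_dim pXi pXj qQi qQj].
move=> [S_comm S_ind S_dim _ _ _ _].
have [j [jiE jjE]] : exists j : {lrmorphism S -> R},
    (forall a, j (iS a) = iA a) /\ (forall c, j (jS c) = jC (jQ c)).
  by apply: (tensor_univ S_comm S_ind S_dim (g := jC \o jQ)) => a c /=.
have [p [q [comm ind dim pi pj qi qj]]] : exists p q, tensor_dec (jC \o iX) j p q.
  apply: tensor_dec_intro => [x s | W Wij t | ] /=.
  - have : s \in (linfun j @^-1: 'C[jC (iX x)])%VS.
      apply: S_ind => a c; rewrite -memv_preim lfunE /= rmorphM /= jiE jjE.
      apply/cent1vP; rewrite -mulrA -rmorphM /= -XQ_comm rmorphM /= !mulrA.
      by rewrite AC_comm.
    by rewrite -memv_preim lfunE /= => /cent1vP->.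
  - apply: AC_ind => a c.
    have : c \in (linfun jC @^-1: (amull (iA a) @^-1: W))%VS.
      apply: XQ_ind => x y; rewrite -!memv_preim !lfunE /= ?lfunE /= rmorphM /=.
      rewrite mulrA AC_comm -mulrA -jjE -jiE -rmorphM; exact: Wij.
    by rewrite -!memv_preim !lfunE /= ?lfunE.
  by rewrite AC_dim XQ_dim S_dim mulnCA.
exists j, q; split=> //= [x | s]; first by rewrite qCj pXi.
have [k kE] := const_morph S X; rewrite -kE.
apply: (tensor_ext S_ind (f := pX \o (qC \o j))) => [a | c] /=.
  by rewrite jiE qCi linearZ /= rmorph1 kE eps_morph.
by rewrite jjE qCj pXj kE eps_morph.
Qed.

(* On rad / rad^2 this is the statement that a block of an invertible 2 x 2   *)
(* block matrix is invertible if the opposite block of the inverse is.        *)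
Lemma tensor_exchange R A B C D
    (iA : {lrmorphism A -> R}) (jC : {lrmorphism C -> R})
    (pA : {lrmorphism R -> A}) (qC : {lrmorphism R -> C})
    (iB : {lrmorphism B -> R}) (jD : {lrmorphism D -> R})
    (pB : {lrmorphism R -> B}) (qD : {lrmorphism R -> D}) :
    tensor_dec iA jC pA qC -> tensor_dec iB jD pB qD ->
    (forall y, exists x, pA (iB x) = y) ->
  forall y, exists x, qD (jC x) = y.
Proof.
move=> decAC decBD surj_pi; apply: (surj_mod_arad2 (f := qD \o jC)) => z Jz /=.
(* The correction by [iB b] makes [pA w] vanish without changing the component in D. Modulo squares
   w is then [jC (qC w)], and [qD] sends it to z. *)
have [b bE] := surj_pi (pA (jD z)); pose w := jD z - iB b; exists (qC w).
have Jb : b \in arad B by rewrite -(arad_morph (pA \o iB)) /= bE !arad_morph.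
have Jw : w \in arad R by rewrite rpredB // arad_morph.
have pw : pA w = 0 by rewrite linearB /= bE subrr.
have qw : qD w = z.
  rewrite linearB /= (td_qj decBD) (td_qi decBD).
  by move: Jb; rewrite mem_arad => /eqP->; rewrite scale0r subr0.
have := arad2_morph qD (tensor_tangent decAC Jw).
by rewrite linearB /= qw linearD /= pw !rmorph0 add0r.
Qed.
End TensorDec.

(** * Splitting off the stable image *)

Section Fitting.
Variable F : fieldType.

(** The kernels of the iterates increase; if the first dim A + 1 inclusions were all strict, the
    dimension would exceed dim A. *)
Lemma lker_stable (A : vectType F) (f : 'End(A)) :
  exists n, (lker (iter n.+1 (comp_lfun f) \1%VF) <= lker (iter n (comp_lfun f) \1%VF))%VS.
Proof.
pose K n := lker (iter n (comp_lfun f) \1%VF).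
have sK n : (K n <= K n.+1)%VS.
  by apply/subvP=> x; rewrite !memv_ker comp_lfunE => /eqP->; rewrite linear0.
case: (boolP [exists n : 'I_(\dim {:A}).+1, (K n.+1 <= K n)%VS]).
  by case/existsP=> n Kn; exists n.
rewrite negb_exists => /forallP nK.
suff /(_ _ (leqnn _)) : forall n, (n <= (\dim {:A}).+1)%N -> (n <= \dim (K n))%N.
  by move/leq_trans/(_ (dimvS (subvf _))); rewrite ltnn.
elim=> // n IHn ltn; apply: leq_ltn_trans (IHn (ltnW ltn)) _.
by rewrite ltn_neqAle (dimv_leqif_sup (sK n)) dimvS ?sK // (nK (Ordinal ltn)).
Qed.

(* X is the stable image of gamma, with the automorphism g induced by gamma;  *)
(* rho \o iota is only required to be onto, not to be the identity.           *)
Record fitting_dec (A X : augalg F) (gamma : A -> A) (iota : {lrmorphism X -> A})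
    (rho : {lrmorphism A -> X}) (g : {lrmorphism X -> X}) : Prop := FittingDec {
  fit_surj : forall y, exists x, g x = y;
  fit_retr : forall y, exists x, rho (iota x) = y;
  fit_rho : forall a, rho (gamma a) = g (rho a);
  fit_iota : forall x, gamma (iota x) = iota (g x);
  fit_nil : exists n, forall a, rho a = 0 -> iter n gamma a = 0 }.

(** For n large, X is A modulo the kernel of gamma^n. Then gamma induces on X an injective, hence
    bijective, [g], while gamma^n induces [iota]; thus [rho \o iota] is g^n, which is onto. *)
Lemma fitting (A : augalg F) (gamma : {lrmorphism A -> A}) :
  exists (X : augalg F) (iota : {lrmorphism X -> A}) (rho : {lrmorphism A -> X})
    (g : {lrmorphism X -> X}), fitting_dec gamma iota rho g.
Proof.
have [n nP] := lker_stable (linfun gamma).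
have iterE m x : iter m (comp_lfun (linfun gamma)) \1%VF x = iter m gamma x.
  by elim: m => [|m IHm] /=; rewrite ?id_lfunE // comp_lfunE IHm lfunE.
have [phi phiE] : exists phi : {lrmorphism A -> A}, forall x, phi x = iter n gamma x.
  elim: n {nP} => [|m [phi phiE]]; first by exists idfun.
  by exists (gamma \o phi) => x /=; rewrite phiE.
have stable x : iter n gamma (gamma x) = 0 -> iter n gamma x = 0.
  rewrite -iterSr => nx; apply/eqP; rewrite -iterE -memv_ker.
  by apply: subvP nP _ _; rewrite memv_ker iterE nx.
have memK x : (x \in lker (linfun phi)) = (iter n gamma x == 0).
  by rewrite memv_ker lfunE /= phiE.
have [|||X [rho [rho_surj rho0]]] := @augalg_quotient F A (lker (linfun phi)).
- by apply/prodvP=> a x _; rewrite !memv_ker !lfunE /= rmorphM /= => /eqP->; rewrite mulr0.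
- by apply/prodvP=> x a; rewrite !memv_ker !lfunE /= rmorphM /= => /eqP-> _; rewrite mul0r.
- by rewrite memv_ker lfunE /= rmorph1 oner_eq0.
have rhoP x : rho x = 0 <-> iter n gamma x = 0.
  by split=> /eqP; [rewrite rho0 memK => /eqP | rewrite -memK -rho0 => /eqP].
have [g gE] : exists g : {lrmorphism X -> X}, forall x, g (rho x) = (rho \o gamma) x.
  apply: lrmorphism_factor => // x /rhoP nx; apply/rhoP.
  by rewrite -iterSr /= nx rmorph0.
have [iota iotaE] : exists iota : {lrmorphism X -> A}, forall x, iota (rho x) = phi x.
  by apply: lrmorphism_factor => // x /rhoP; rewrite phiE.
have g_surj y : exists x, g x = y.
  have ginj : injective g.
    move=> u v; have [[x <-] [y' <-]] := (rho_surj u, rho_surj v).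
    move/eqP; rewrite !gE -subr_eq0 -!rmorphB => /eqP/rhoP/stable/rhoP.
    by rewrite rmorphB => /eqP; rewrite subr_eq0 => /eqP.
  by have [h _ hK] := linear_inj_bij ginj; exists (h y); apply: hK.
exists X, iota, rho, g; split=> // [y | x | ].
- have [z <-] : exists z, iter n g z = y.
    elim: n {phiE stable memK rhoP nP iterE rho0} y => [|m IHm] y; first by exists y.
    by have [u <-] := g_surj y; have [z <-] := IHm u; exists z.
  exists z; have [x <-] := rho_surj z; rewrite iotaE phiE.
  by elim: (n) => //= m <-; rewrite gE.
- by have [a <-] := rho_surj x; rewrite gE !iotaE !phiE -iterS iterSr.
- by exists n => a /rhoP.
Qed.

End Fitting.

Section Splitting.
Variable F : fieldType.
Implicit Types A B C D R S X Q : augalg F.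

(** The two composites of [u] and [v] have the same stable image, so one X serves for both A and
    B. *)
Lemma fitting_swap A B X (u : {lrmorphism A -> B}) (v : {lrmorphism B -> A})
    (iota : {lrmorphism X -> A}) (rho : {lrmorphism A -> X}) (g : {lrmorphism X -> X}) :
  fitting_dec (v \o u) iota rho g -> fitting_dec (u \o v) (u \o iota) (rho \o v) g.
Proof.
case=> g_surj retr rhoE iotaE [n nP]; split=> //= [y | b | x | ].
- have [x <-] := g_surj y; have [z <-] := retr x.
  by exists z; rewrite -rhoE.
- by rewrite -rhoE.
- by rewrite -iotaE.
(* The (n+1)-st iterate of [u \o v] is [u], after n iterations of [v \o u], after [v]. *)
exists n.+1 => b /nP /(congr1 u); rewrite rmorph0 => <-.
by elim: (n) => //= m ->.
Qed.

(** Take k' = k + gamma k + gamma^2 k + ..., a finite sum because gamma is nilpotent on the kernel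
    of [rho]. *)
Lemma fitting_telescope A X (gamma : {lrmorphism A -> A}) (iota : {lrmorphism X -> A})
    (rho : {lrmorphism A -> X}) (g : {lrmorphism X -> X}) :
    fitting_dec gamma iota rho g ->
  forall k, k \in arad A -> rho k = 0 ->
  exists k', [/\ k' \in arad A, rho k' = 0 & k = k' - gamma k'].
Proof.
case=> _ _ rhoE _ [n nP] k Jk rk; move/nP: (rk).
elim: n k Jk rk {nP} => [|n IHn] k Jk rk nk.
  by exists 0; rewrite mem0v !rmorph0 subr0.
have [|||k' [Jk' rk' k'E]] := IHn (gamma k).
- by rewrite arad_morph.
- by rewrite rhoE rk rmorph0.
- by rewrite -iterSr.
exists (k + k'); split; first by rewrite rpredD.
  by rewrite rmorphD /= rk rk' addr0.
by rewrite rmorphD /= opprD addrACA -k'E subrK.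
Qed.

Section Data.
Variables (R A B C D X : augalg F).
Variables (iA : {lrmorphism A -> R}) (jC : {lrmorphism C -> R}).
Variables (pA : {lrmorphism R -> A}) (qC : {lrmorphism R -> C}).
Variables (iB : {lrmorphism B -> R}) (jD : {lrmorphism D -> R}).
Variables (pB : {lrmorphism R -> B}) (qD : {lrmorphism R -> D}).
Variables (iota : {lrmorphism X -> A}) (rho : {lrmorphism A -> X}).
Variable g : {lrmorphism X -> X}.

(** Here A denotes the algebra to be split, and R = A (x) C = B (x) D. The cancellation step uses
    this section twice, with the cancelled factor and with B in the role of A. *)
Let gamma : {lrmorphism A -> A} := (pA \o iB) \o (pB \o iA).
Let P : {lrmorphism D -> A} := pA \o jD.
Let delta : {lrmorphism A -> A} := P \o (qD \o iA).

Hypothesis decAC : tensor_dec iA jC pA qC.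
Hypothesis decBD : tensor_dec iB jD pB qD.
Hypothesis fit : fitting_dec gamma iota rho g.

(** As [g] is onto, [iota x] lies in the image of gamma, hence is the image under [pA] of an element
    of B, which commutes with D in R. *)
Lemma split_comm x d : iota x * P d = P d * iota x.
Proof.
have [y <-] := fit_surj fit x; rewrite -(fit_iota fit) /= -!rmorphM.
by rewrite (td_comm decBD).
Qed.

Lemma split_tangent y : y \in arad A -> y - (gamma y + delta y) \in arad2 A.
Proof.
move=> Jy; have JR : iA y \in arad R by rewrite arad_morph.
have := arad2_morph pA (tensor_tangent decBD JR).
by rewrite linearB linearD /= (td_pi decAC).
Qed.

Lemma split_arad y : y \in arad A ->
  exists x k, [/\ x \in arad X, k \in arad A, rho k = 0 & y = iota x + k].
Proof.
move=> Jy; have [x xE] := fit_retr fit (rho y).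
have Jx : x \in arad X by rewrite -(arad_morph (rho \o iota)) /= xE arad_morph.
exists x, (y - iota x); split=> //; last by rewrite addrC subrK.
  by rewrite rpredB ?arad_morph.
by rewrite linearB /= xE subrr.
Qed.

(** The product is a subalgebra by commutation. It fills the radical modulo its square: on the
    kernel of [rho] one has k = k' - gamma k', which is delta k' modulo squares. *)
Lemma split_full : (limg (linfun iota) * limg (linfun P) = fullv)%VS.
Proof.
have PX : (limg (linfun P) * limg (linfun iota) <= limg (linfun iota) * limg (linfun P))%VS.
  apply/prodvP=> _ _ /memv_imgP[d _ ->] /memv_imgP[x _ ->]; rewrite !lfunE.
  rewrite -[X in X \in _]/(P d * iota x) -split_comm.
  by apply: memv_mul; apply: memv_linfun; apply: memvf.
have im_mul (S : augalg F) (f : {lrmorphism S -> A}) :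
    (limg (linfun f) * limg (linfun f) <= limg (linfun f))%VS.
  by have := expv_limg f fullv 2; rewrite !expv2 => ->; rewrite limgS ?subvf.
have im1 (S : augalg F) (f : {lrmorphism S -> A}) : 1 \in limg (linfun f).
  by rewrite -(rmorph1 f); apply: memv_linfun; apply: memvf.
apply: subalg_full => [||y Jy].
- by rewrite -[1]mulr1 memv_mul.
- rewrite prodvA -(prodvA _ _ (limg (linfun iota))).
  apply: subv_trans (prodvSl _ (prodvSr _ PX)) _.
  by rewrite prodvA -prodvA prodvS.
have [x [k [Jx Jk rk ->]]] := split_arad Jy.
have [k' [Jk' rk' ->]] := fitting_telescope fit Jk rk.
exists (iota x + delta k').
  apply: memvD.
    by rewrite -[iota x]mulr1 memv_mul ?im1 //; apply: memv_linfun; apply: memvf.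
  rewrite -[delta k']mul1r memv_mul ?im1 //.
  by apply: (memv_linfun P); apply: memvf.
by rewrite opprD addrACA subrr add0r -addrA -opprD split_tangent.
Qed.

Let I : {vspace A} := (linfun iota @: arad X * fullv)%VS.

(** I is built as a right ideal. It is also a left one because A is spanned by products of [iota] X,
    which preserves [iota] of the radical, and the image of D, which commutes with it. *)
Lemma split_ideal_l : (fullv * I <= I)%VS.
Proof.
rewrite /I prodvA; suff: (fullv * (linfun iota @: arad X) <= I)%VS.
  by move=> fJ; apply: subv_trans (prodvSl _ fJ) _; rewrite -prodvA prodvSr ?subvf.
rewrite -split_full -prodvA.
apply: (@subv_trans _ _ (limg (linfun iota) * (linfun iota @: arad X * limg (linfun P)))%VS).
  apply/prodvSr/prodvP=> _ _ /memv_imgP[d _ ->] /memv_imgP[x Jx ->]; rewrite !lfunE.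
  rewrite -[X in X \in _]/(P d * iota x) -split_comm.
  by apply: memv_mul; apply: memv_linfun; rewrite ?memvf.
rewrite prodvA; apply: prodvS (subvf _).
apply/prodvP=> _ _ /memv_imgP[x _ ->] /memv_imgP[y Jy ->]; rewrite !lfunE /=.
by rewrite -rmorphM; apply: memv_linfun; apply: aradMl.
Qed.

Lemma split_ideal_r : (I * fullv <= I)%VS.
Proof. by rewrite /I -prodvA prodvSr ?subvf. Qed.

Lemma split_ideal_arad : (I <= arad A)%VS.
Proof.
apply/prodvP=> _ a /memv_imgP[x Jx ->] _; rewrite lfunE /=.
by apply: aradMr; rewrite arad_morph.
Qed.

Lemma split_ideal_iota x : x \in arad X -> iota x \in I.
Proof.
move=> Jx; rewrite -[iota x]mulr1; apply: memv_mul (memvf _).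
exact: memv_linfun.
Qed.

Lemma split_dim : (\dim {:A} <= \dim {:X} * \dim I^C)%N.
Proof.
(* Writing A = I^C + I in the error term iota(rad^k) A moves the error to iota(rad^(k+1)) A;
   nilpotency then leaves A = iota(X) I^C. *)
have cover k : (fullv <= limg (linfun iota) * I^C + linfun iota @: (arad X ^+ k) * fullv)%VS.
  elim: k => [|k IHk].
    apply: subv_trans (addvSr _ _); rewrite -{1}[fullv]prod1v prodvSl //.
    by rewrite -expv_limg expv0.
  apply: subv_trans IHk _; rewrite subv_add addvSl /= -expv_limg.
  rewrite -{1}(addv_complf I) prodvDr subv_add; apply/andP; split.
    by apply: subv_trans (addvSr _ _); rewrite /I prodvA -expvSr expv_limg.
  apply: subv_trans (addvSl _ _); apply: prodvSl.
  by rewrite expv_limg limgS ?subvf.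
have [n Jn] := arad_nil X; have := cover n.
rewrite Jn limg0 prod0v addv0 => /dimvS /leq_trans; apply.
apply: leq_trans (dim_prodv _ _) _; rewrite leq_mul2r.
by rewrite -(limg_ker_dim (linfun iota) fullv) leq_addl orbT.
Qed.

(** The map [theta] from A to X (x) Q is onto by a check modulo squares, and [split_dim] makes it
    bijective. The formula for [p] is kept because it allows the projections to X of the two
    splittings to be compared. *)
Lemma split_tensor : exists (Q : augalg F) (e : {lrmorphism X -> A})
    (e' : {lrmorphism Q -> A}) (p : {lrmorphism A -> X}) (q : {lrmorphism A -> Q}),
  tensor_dec e e' p q /\ forall a, p a = rho (gamma a).
Proof.
have nI1 : 1 \notin I.
  by apply: contra (one_notin_arad A); apply/subvP/split_ideal_arad.
have [Q [pi [pi_surj pi0]]] := augalg_quotient split_ideal_l split_ideal_r nI1.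
have dimQ : \dim I^C = \dim {:Q}.
  have kerpi : lker (linfun pi) = I.
    by apply/vspaceP=> x; rewrite memv_ker lfunE /= pi0.
  have impi : limg (linfun pi) = fullv.
    apply/vspaceP=> y; rewrite memvf; have [x <-] := pi_surj y.
    by apply: memv_linfun; apply: memvf.
  have := limg_ker_dim (linfun pi) fullv; rewrite capfv kerpi impi => dimA.
  by rewrite dimv_compl -dimA addKn.
have [T [tX [tQ [pX [pQ [decT _]]]]]] := tensor_exists X Q.
have [h [hB hD]] : exists h : {lrmorphism R -> T},
    (forall b, h (iB b) = tX (rho (pA (iB b)))) /\
    (forall d, h (jD d) = tQ (pi (P d))).
  apply: (tensor_univ (td_comm decBD) (td_ind decBD) (td_dim decBD)
    (f := tX \o (rho \o (pA \o iB))) (g := tQ \o (pi \o P))) => b d /=.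
  by rewrite (td_comm decT).
have theta_tangent a : a \in arad A ->
    h (iA a) - (tX (rho (gamma a)) + tQ (pi (delta a))) \in arad2 T.
  move=> Ja; have JR : iA a \in arad R by rewrite arad_morph.
  have := arad2_morph h (tensor_tangent decBD JR).
  by rewrite linearB linearD /= hB hD.
have piI x : x \in I -> pi x = 0 by rewrite -pi0 => /eqP.
have pi_tangent a : a \in arad A -> pi (a - gamma a) - pi (delta a) \in arad2 Q.
  move=> Ja; have := arad2_morph pi (split_tangent Ja).
  by rewrite opprD addrA linearB.
(* Lift x through [rho \o iota \o g]. The Q-component of the lift dies modulo squares: delta is the
   identity minus gamma there, and [iota x2 - gamma (iota x2)] lies in [iota] of the radical, hence
   in I. *)
have theta_X x : x \in arad X -> exists2 a, a \in arad A & tX x - h (iA a) \in arad2 T.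
  move=> Jx; have [x1 x1E] := fit_retr fit x; have [x2 x2E] := fit_surj fit x1.
  have Jx2 : x2 \in arad X by rewrite -(arad_morph g) x2E -(arad_morph (rho \o iota)) /= x1E.
  have Ja : iota x2 \in arad A by rewrite arad_morph.
  exists (iota x2) => //; rewrite -opprB memvN.
  have t1 := theta_tangent _ Ja.
  have t2 : tQ (pi (delta (iota x2))) \in arad2 T.
    have := arad2_morph tQ (pi_tangent _ Ja); rewrite (fit_iota fit) -[iota x2 - _]linearB.
    rewrite [pi (iota _)]piI; last by rewrite split_ideal_iota // rpredB ?arad_morph.
    by rewrite sub0r linearN memvN.
  have := memvD t1 t2; rewrite opprD addrA subrK.
  by rewrite (fit_iota fit) x2E x1E.
(* The summand in [iota] X dies in Q, and the rest is k' - gamma k' with [rho k'] = 0. So k' has no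
   X-component and its Q-component is the required one modulo squares. *)
have theta_Q q : q \in arad Q -> exists2 a, a \in arad A & tQ q - h (iA a) \in arad2 T.
  have [y <-] := pi_surj q; rewrite arad_morph => Jy.
  have [x [k [Jx Jk rk ->]]] := split_arad Jy.
  have [k' [Jk' rk' kE]] := fitting_telescope fit Jk rk.
  exists k' => //; rewrite linearD /= (piI (iota x)) ?split_ideal_iota // add0r kE.
  have := theta_tangent _ Jk'; rewrite (fit_rho fit) rk' !rmorph0 add0r => t1.
  have := arad2_morph tQ (pi_tangent _ Jk'); rewrite linearB /= => t2.
  by have := memvB t2 t1; rewrite opprB addrA subrK.
pose theta : {lrmorphism A -> T} := h \o iA.
have theta_surj : forall t, exists a, theta a = t.
  apply: surj_mod_arad2 => z Jz.
  have [|a Ja aE] := theta_X (pX z); first by rewrite arad_morph.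
  have [|b Jb bE] := theta_Q (pQ z); first by rewrite arad_morph.
  exists (a + b); have := memvD (tensor_tangent decT Jz) (memvD aE bE).
  by rewrite [X in _ + X]addrACA [X in X \in _]addrA subrK -opprD [theta _]linearD.
have dimA : \dim {:A} = \dim {:T}.
  apply/eqP; rewrite eqn_leq; apply/andP; split.
    by rewrite (td_dim decT) -dimQ split_dim.
  have <- : limg (linfun theta) = fullv.
    apply/vspaceP=> t; rewrite memvf; have [a <-] := theta_surj t.
    by apply: memv_linfun; apply: memvf.
  by rewrite -(limg_ker_dim (linfun theta) fullv) leq_addl.
have [zeta thetaK zetaK] := lrmorphism_inv (linear_surj_bij dimA theta_surj).
have pX_theta a : pX (theta a) = rho (gamma a).
  rewrite /theta /=.
  apply: (tensor_ext (td_ind decBD) (f := pX \o h) (g := rho \o (pA \o (iB \o pB)))) => [b | d] /=.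
    by rewrite hB (td_pi decT) (td_pi decBD).
  rewrite hD (td_pj decT) (td_pj decBD) !eps_morph.
  by rewrite [iB _]linearZ [pA _]linearZ [rho _]linearZ !rmorph1.
have iso_TA : alg_iso T A by exists zeta; exists theta.
exists Q, (zeta \o tX), (zeta \o tQ), (rho \o gamma), (pQ \o theta).
split=> //; split=> /= [x q | W Wt a | | x | q | x | q].
- by rewrite -!rmorphM (td_comm decT).
- rewrite -[a]thetaK -(lfunE zeta) memv_preim; apply: (td_ind decT) => x q.
  rewrite -memv_preim lfunE /= rmorphM; exact: Wt.
- by rewrite dimA (td_dim decT).
- by rewrite -[LHS]pX_theta zetaK (td_pi decT).
- by rewrite -[LHS]pX_theta zetaK (td_pj decT).
- by rewrite [h _]zetaK (td_qi decT).
- by rewrite [h _]zetaK (td_qj decT).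
Qed.
End Data.
End Splitting.

(** * Cancellation by induction on the dimension of the common factor *)

Section Cancellation.
Variable F : fieldType.
Implicit Types A B C R S X Q : augalg F.

Lemma arad_dim1 X x : \dim {:X} = 1%N -> x \in arad X -> x = 0.
Proof.
move=> dimX Jx; apply/eqP; rewrite -memv0.
suff /eqP <- : arad X == 0%VS by [].
rewrite -dimv_eq0 -leqn0 -ltnS -dimX ltn_neqAle dimvS ?subvf // andbT.
apply: contra (one_notin_arad X) => dimJ.
have /eqP -> : arad X == fullv by rewrite eqEdim subvf (eqP dimJ) leqnn.
exact: memvf.
Qed.

Lemma tensor_dim_cancel R A B C
    (iA : {lrmorphism A -> R}) (jC : {lrmorphism C -> R})
    (pA : {lrmorphism R -> A}) (qC : {lrmorphism R -> C})
    (iB : {lrmorphism B -> R}) (jD : {lrmorphism C -> R})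
    (pB : {lrmorphism R -> B}) (qD : {lrmorphism R -> C}) :
  tensor_dec iA jC pA qC -> tensor_dec iB jD pB qD -> \dim {:A} = \dim {:B}.
Proof.
move=> decAC decBC; apply/eqP.
have C_gt0 : (0 < \dim {:C})%N by rewrite dimvf FalgType_proper.
by rewrite -(eqn_pmul2r C_gt0) -(td_dim decAC) -(td_dim decBC).
Qed.

Lemma tensor_cancel n R A B C
    (iA : {lrmorphism A -> R}) (jC : {lrmorphism C -> R})
    (pA : {lrmorphism R -> A}) (qC : {lrmorphism R -> C})
    (iB : {lrmorphism B -> R}) (jD : {lrmorphism C -> R})
    (pB : {lrmorphism R -> B}) (qD : {lrmorphism R -> C}) :
    (\dim {:C} <= n)%N ->
  tensor_dec iA jC pA qC -> tensor_dec iB jD pB qD -> alg_iso A B.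
Proof.
elim: n R A B C iA jC pA qC iB jD pB qD => [|n IHn] R A B C iA jC pA qC iB jD pB qD.
  by rewrite leqNgt dimvf FalgType_proper.
move=> dimC decAC decBC; have decCA := tensor_dec_sym decAC.
have decCB := tensor_dec_sym decBC.
have [X [iota [rho [g fit]]]] := fitting ((qC \o iB) \o (pB \o jC)).
(* If X = F, then [rho] kills rad C, so every radical element is k - gamma k and hence comes, modulo
   squares, from the second copy of C. *)
have [dimX | dimX] := eqVneq (\dim {:X}) 1%N.
  have surjC : forall y, exists x, qC (jD x) = y.
    apply: (surj_mod_arad2 (f := qC \o jD)) => y Jy.
    have [|k [Jk _ ->]] := fitting_telescope fit Jy.
      by apply: arad_dim1 => //; rewrite arad_morph.
    exists (qD (jC k)); have := split_tangent decCA decBC Jk.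
    by rewrite opprD addrA.
  apply: (alg_iso_surj (f := pB \o iA)); first exact: tensor_dim_cancel decAC decBC.
  exact: tensor_exchange decCA decCB surjC.
have [Q [e [e' [p [q [decXQ pE]]]]]] := split_tensor decCA decBC fit.
have [Q' [f [f' [p' [q' [decXQ' pE']]]]]] :=
  split_tensor decBC decCA (fitting_swap fit).
have [S1 [i1 [j1 [p1 [q1 [dec1 _]]]]]] := tensor_exists A Q.
have [S2 [i2 [j2 [p2 [q2 [dec2 _]]]]]] := tensor_exists Q' C.
have [k1 [r1 decXS1]] := tensor_dec_assoc decAC decXQ dec1.
have [k2 [r2 decXS2]] := tensor_dec_assoc decCB decXQ' (tensor_dec_sym dec2).
(* By the two formulas for the projections, both composites to X agree on B, so this map is the
   identity of X. *)
have surjX : forall y, exists x, (p \o qC) ((iB \o f) x) = y.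
  by move=> y; exists y; rewrite /= pE -[RHS](td_pi decXQ') pE'.
have isoS : alg_iso S1 S2.
  apply: (alg_iso_surj (f := r2 \o k1)).
    exact: tensor_dim_cancel (tensor_dec_sym decXS1) (tensor_dec_sym decXS2).
  exact: tensor_exchange decXS1 decXS2 surjX.
have [a1 [a2 [a3 [a4 decAQ]]]] := tensor_dec_iso dec1 isoS.
(* In Q' (x) C the factor C is Q (x) X, and X (x) Q' is B; thus A (x) Q and B (x) Q are
   isomorphic. *)
have [b1 [b2 decQB]] :=
  tensor_dec_assoc dec2 (tensor_dec_sym decXQ) (tensor_dec_sym decXQ').
apply: IHn decAQ (tensor_dec_sym decQB).
have X_gt1 : (1 < \dim {:X})%N by rewrite ltn_neqAle eq_sym dimX dimvf FalgType_proper.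
have Q_gt0 : (0 < \dim {:Q})%N by rewrite dimvf FalgType_proper.
rewrite -ltnS; apply: leq_trans dimC; rewrite (td_dim decXQ).
by rewrite -[X in (X < _)%N]mul1n ltn_pmul2r.
Qed.

End Cancellation.

(** * Local algebras over a splitting field *)

Section LocalSplit.
Variables (F : fieldType) (A : falgType F).
Implicit Types M N : {vspace A}.

(** Otherwise M would extend to a maximal left ideal, which contains both x and 1 - x. *)
Lemma jacobson_quasi_inverse M x : left_ideal M -> x \in jacobson_vs A ->
  1 - x \in M -> 1 \in M.
Proof.
move=> lM Jx Mx; apply/negPn/negP=> nM1.
have nM : M <> fullv by move=> MF; rewrite MF memvf in nM1.
pose Qd d := `[< exists N, [/\ left_ideal N, (M <= N)%VS, N <> fullv & \dim N = d] >].
have exQ : exists d, Qd d by exists (\dim M); apply/asboolP; exists M.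
have Qle d : Qd d -> (d <= \dim {:A})%N.
  by case/asboolP=> N [_ _ _ <-]; apply/dimvS/subvf.
case: (ex_maxnP exQ Qle) => d /asboolP[N [lN sMN nN dN]] dmax.
have maxN : maximal_left_ideal N.
  split=> // L lL sNL nL; apply/eqP; rewrite eq_sym eqEdim sNL dN; apply: dmax.
  by apply/asboolP; exists L; split=> //; apply: subv_trans sNL.
case/negP: (one_notin_left_ideal lN nN).
rewrite -(subrK x 1); apply: rpredD; first exact: subvP sMN _ Mx.
by move/jacobson_vsP: Jx; apply.
Qed.

(** Let N be maximal among left ideals strictly inside M. If xm were outside N for some x in J and m
    in M, then M = N + A x m, so (1 - bx) m lies in N for some b, and quasi-inversion puts m in N.
    Hence JM lies in N, a contradiction. *)
Lemma jacobson_nakayama M : left_ideal M -> (M <= jacobson_vs A * M)%VS -> M = 0%VS.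
Proof.
move=> lM sMJM; apply/eqP/negPn/negP=> nzM.
pose Qd d := `[< exists N, [/\ left_ideal N, (N <= M)%VS, N <> M & \dim N = d] >].
have exQ : exists d, Qd d.
  exists 0%N; apply/asboolP; exists 0%VS; split; rewrite ?sub0v ?dimv0 //.
    by rewrite /left_ideal prodv0.
  by move/eqP; rewrite eq_sym (negPf nzM).
have Qle d : Qd d -> (d <= \dim {:A})%N.
  by case/asboolP=> N [_ _ _ <-]; apply/dimvS/subvf.
case: (ex_maxnP exQ Qle) => d /asboolP[N [lN sNM nN dN]] dmax.
suff: (M <= N)%VS by move=> sMN; apply: nN; apply/eqP; rewrite eqEsubv sNM.
apply: subv_trans sMJM _; apply/prodvP=> x m Jx Mm.
apply/negPn/negP=> nNxm.
pose L := (N + linfun (amulr (x * m)) @: fullv)%VS.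
have LP a b : a \in N -> a + b * (x * m) \in L.
  move=> Na; apply: memv_add => //; apply/memv_imgP; exists b; rewrite ?memvf //.
  by rewrite lfunE /= lfunE.
have lL : left_ideal L.
  apply/prodvP=> b _ _ /memv_addP[a Na [_ /memv_imgP[c _ ->] ->]].
  by rewrite lfunE /= lfunE /= mulrDr mulrA LP // left_idealP.
have LM : L = M.
  apply/eqP/negPn/negP=> nLM.
  have sNL : (N <= L)%VS by apply: addvSl.
  have sLM : (L <= M)%VS.
    rewrite subv_add sNM; apply/subvP=> _ /memv_imgP[b _ ->].
    by rewrite lfunE /= lfunE /= mulrA left_idealP.
  have dL : (\dim L <= d)%N.
    by apply: dmax; apply/asboolP; exists L; split=> //; apply/eqP.
  have /eqP NL : N == L by rewrite eqEdim sNL dN.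
  by case/negP: nNxm; rewrite NL -[x * m]add0r -[x * m]mul1r LP ?mem0v.
have: m \in L by rewrite LM.
case/memv_addP=> a Na [_ /memv_imgP[b _ ->]]; rewrite lfunE /= lfunE /= => mE.
pose K := (linfun (amulr m) @^-1: N)%VS.
have inK y : (y \in K) = (y * m \in N) by rewrite -memv_preim lfunE /= lfunE.
have lK : left_ideal K.
  by apply/prodvP=> c y _; rewrite !inK -mulrA; apply: left_idealP.
have Jbx : b * x \in jacobson_vs A by apply: (tsideal_mull (I := jacobson A)).
have: 1 \in K.
  apply: (jacobson_quasi_inverse lK Jbx).
  by rewrite inK mulrBl mul1r {1}mE mulrA addrK.
rewrite inK mul1r => Nm; case/negP: nNxm; exact: left_idealP.
Qed.

(** The powers of J cannot decrease strictly forever, and by Nakayama a power that equals the next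
    one is 0. *)
Lemma jacobson_nilpotent : exists n, (jacobson_vs A ^+ n = 0)%VS.
Proof.
pose J := jacobson_vs A.
have lJ : left_ideal J by case/and3P: (jacobson_ideal A).
have sJ n : (J ^+ n.+2 <= J ^+ n.+1)%VS.
  elim: n => [|n IHn]; last by rewrite expvSl [X in (_ <= X)%VS]expvSl prodvSr.
  by rewrite expv2 expv1; apply: subv_trans lJ; rewrite prodvSl ?subvf.
case: (boolP [exists n : 'I_(\dim {:A}).+1, (J ^+ n.+1 <= J ^+ n.+2)%VS]).
  case/existsP=> n Jn; exists n.+1; apply: jacobson_nakayama.
    rewrite /left_ideal expvSl prodvA prodvSl //.
  by rewrite -expvSl.
rewrite negb_exists => /forallP nJ.
suff /(_ _ (leqnn _)) : forall n, (n <= (\dim {:A}).+1)%N ->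
    (\dim (J ^+ n.+1) + n <= \dim {:A})%N.
  by move/(leq_trans (leq_addl _ _)); rewrite ltnn.
elim=> [_ | n IHn ltn]; first by rewrite addn0 dimvS ?subvf.
apply: leq_trans (IHn (ltnW ltn)); rewrite addnS -addSn leq_add2r.
by rewrite ltn_neqAle (dimv_leqif_sup (sJ n)) dimvS ?sJ // (nJ (Ordinal ltn)).
Qed.

Lemma augalg_of_local : local_algebra A -> splitting_field A ->
  exists A' : augalg F, aug_alg A' = A :> falgType F.
Proof.
move=> locA [n [d [f [f' fK f'K]]]].
pose M := prodalg (fun i : 'I_n.+1 => 'M[F]_((d i).+1) : algType F).
(* A nonzero idempotent of a division algebra is 1. Applied to this matrix unit, it gives m = E m E,
   so each m is a scalar, its corner entry, and A / J is F. *)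
pose E : M := [ffun i => if i == ord0 then delta_mx 0 0 else 0].
have E2 : E * E = E.
  apply/ffunP=> i; rewrite !ffunE; case: eqP => // _; last by rewrite mulr0.
  by rewrite -[_ * _]/(_ *m _) mul_delta_mx.
have Enz : E != 0.
  apply/eqP=> /ffunP/(_ ord0); rewrite !ffunE eqxx => /matrixP/(_ 0 0).
  by rewrite !mxE !eqxx => /eqP; rewrite oner_eq0.
have fbij : bijective f by exists f'.
have [g _ gK] := lrmorphism_inv fbij.
have E1 : E = 1.
  have gE_unit : g E \is a GRing.unit.
    by apply: locA; apply: contraNneq Enz => gE0; rewrite -[E]gK gE0 rmorph0.
  have : g E = 1 by apply: (mulrI gE_unit); rewrite -rmorphM E2 mulr1.
  by move/(congr1 f); rewrite gK rmorph1.
have scalarM (m : M) : m = m ord0 0 0 *: 1.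
  rewrite -E1 -{1}[m]mul1r -{1}[m]mulr1 -E1 mulrA.
  apply/ffunP=> i; rewrite !ffunE; case: eqP => [-> | _]; last first.
    by rewrite !mul0r scaler0.
  rewrite -[LHS]/(delta_mx 0 0 *m m ord0 *m delta_mx 0 0).
  apply/matrixP=> k l; rewrite !mxE (bigD1 0) //= big1 => [|j /negPf j0].
    rewrite !mxE (bigD1 0) //= big1 => [|j /negPf j0]; last by rewrite !mxE j0 andbF mul0r.
    by rewrite !mxE eqxx andbT !addr0; case: (k == 0); case: (l == 0);
      rewrite ?(mul1r, mulr1, mul0r, mulr0).
  by rewrite !mxE j0 mulr0.
pose e x : F^o := f (quot_pi (jacobson A) x) ord0 0 0.
have fE x : f (quot_pi (jacobson A) x) = e x *: 1 by apply: scalarM.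
have e_linear : linear e.
  by move=> a x y; rewrite /e !linearP /= !ffunE !mxE.
have one00 c : (c *: (1 : M)) ord0 0 0 = c.
  by rewrite !ffunE !mxE mulr1.
have e_mul : monoid_morphism e.
  split=> [|x y]; first by rewrite /e !rmorph1 -[1 : M]scale1r one00.
  by rewrite {1}/e !rmorphM /= !fE -scalerAl mul1r scalerA one00.
pose e' : {lrmorphism A -> F^o} := HB.pack e
  (GRing.isLinear.Build F A F^o _ e e_linear)
  (GRing.isMonoidMorphism.Build A F^o e e_mul).
have nil_e : exists n, (lker (linfun e') ^+ n = 0)%VS.
  have [k Jk] := jacobson_nilpotent; exists k.
  apply/eqP; rewrite -subv0 -Jk; apply/expvS/subvP=> x.
  rewrite memv_ker lfunE /= -(quot_pi_eq0 (jacobson A)) => /eqP ex.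
  by rewrite -[quot_pi _ x]fK fE ex scale0r -(rmorph0 f) fK.
by exists (AugAlg nil_e).
Qed.
End LocalSplit.

Theorem corollary2 (F : fieldType) (A B C : falgType F)
  (locA : local_algebra A) (locB : local_algebra B) (locC : local_algebra C)
  (splA : splitting_field A) (splB : splitting_field B)
  (splC : splitting_field C) :
  alg_iso (tensalg A C) (tensalg B C) -> alg_iso A B.
Proof.
have [A' <-] := augalg_of_local locA splA.
have [B' <-] := augalg_of_local locB splB.
have [C' <-] := augalg_of_local locC splC.
have [R [i [j [p [q [decAC RAC]]]]]] := tensor_exists A' C'.
have [S [i' [j' [p' [q' [decBC SBC]]]]]] := tensor_exists B' C'.
move=> isoAC; have isoRS : alg_iso R S by rewrite RAC SBC.
have [k [l [r [s decS]]]] := tensor_dec_iso decAC isoRS.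
exact: tensor_cancel (leqnn _) decS decBC.
Qed.
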